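(* Let $w$ be an aperiodic recurrent (right) infinite word over a finite alphabet. Then $w$ is Sturmian if and only if each factor of $w$ has two or three abelian returns in $w$.
   Context: Words: $\Sigma$ is a finite non-empty alphabet; $\Sigma^\omega$ is the set of right infinite words $w=w_1w_2\cdots$ over $\Sigma$. A factor of $w$ is a finite block of consecutive letters occurring in $w$. $|u|$ is the length of a finite word $u$, and $|u|_a$ is the number of occurrences of the letter $a$ in $u$. The word $w$ is periodic if there is an integer $T\ge 1$ such that $w_{n+T}=w_n$ for every $n$; it is aperiodic if it is not periodic. It is recurrent if each of its factors occurs infinitely many times in $w$. Sturmian: an infinite word is Sturmian if for every $n\ge 0$ it has exactly $n+1$ distinct factors of length $n$. Abelian returns: finite words $u,v$ are abelian equivalent, written $u\approx^{ab}v$, if $|u|_a=|v|_a$ for all $a\in\Sigma$. For a recurrent infinite word $w$ and a factor $u$ of $w$, let $n_1<n_2<\cdots$ be all the integers $n_i$ such that $w_{n_i}\cdots w_{n_i+|u|-1}\approx^{ab}u$. Each word $w_{n_i}\cdots w_{n_{i+1}-1}$ is called an abelian return (word) of $u$ in $w$. The factor $u$ has $k$ abelian returns if the set of its abelian returns consists of exactly $k$ classes for abelian equivalence. *)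

(* Defs.v *)
From mathcomp Require Import all_boot.
From mathcomp Require Import boolp classical_sets functions cardinality.

Set Implicit Arguments.
Unset Strict Implicit.
Unset Printing Implicit Defensive.

Local Open Scope classical_set_scope.
Local Open Scope card_scope.

(* An infinite word over the finite alphabet A is a function w : nat -> A,   *)
(* with positions starting at 0: the letter w_n is w n.-1.  The empty word   *)
(* is a factor of every infinite word.                                       *)
Section InfiniteWords.
Variables (A : finType) (w : nat -> A).
Implicit Types (u v : seq A).

Definition block (i n : nat) : seq A := [seq w j | j <- iota i n].

Definition occurrence u : set nat := [set i | block i (size u) = u].

Definition factor u : Prop := exists i, occurrence u i.

Definition periodic : Prop :=
  exists T : nat, 1 <= T /\ forall n, w (n + T) = w n.

Definition aperiodic : Prop := ~ periodic.

Definition recurrent : Prop :=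
  forall u, factor u -> infinite_set (occurrence u).

Definition sturmian : Prop :=
  forall n : nat, [set u : seq A | size u = n /\ factor u] #= `I_n.+1.

Definition abelian_equiv u v : Prop :=
  forall a : A, count_mem a u = count_mem a v.

Lemma abelian_equivP u v : reflect (abelian_equiv u v) (perm_eq u v).
Proof.
apply: (iffP idP) => [/permP uv a|uv]; first exact: uv.
by apply/allP => a _; apply/eqP; exact: uv.
Qed.

Definition abelian_occurrence u : set nat :=
  [set n | abelian_equiv (block n (size u)) u].

Definition abelian_return u : set (seq A) :=
  [set v | exists m n : nat,
     [/\ m < n, abelian_occurrence u m, abelian_occurrence u n,
         (forall k, m < k < n -> ~ abelian_occurrence u k)
       & v = block m (n - m)]].

Definition abelian_return_classes u : set (set (seq A)) :=
  [set [set v' | abelian_return u v' /\ abelian_equiv v v']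
     | v in abelian_return u].

Definition has_abelian_returns u (k : nat) : Prop :=
  abelian_return_classes u #= `I_k.

End InfiniteWords.

(* Main.v *)
Require Import Defs.
From mathcomp Require Import all_boot.
From mathcomp Require Import boolp classical_sets cardinality.
From mathcomp Require Import zify.

Set Implicit Arguments.
Unset Strict Implicit.
Unset Printing Implicit Defensive.

(* A long prefix of [w] recurs at some distance [n]; while the two copies
   agree, sliding a window of length [n] does not change its abelian class, so
   every letter is an abelian return of that class.  Hence three letters would
   give four returns, and [w] is binary.

   Call a binary word balanced if no [0z0] and [1z1] are both factors; among
   aperiodic recurrent words these are the Sturmian ones, since balance means
   that there is one right special factor of each length.

   Sturmian words have two or three returns: the windows of length [s] with the
   largest number of ones form an upper set [H] for the lexicographic order on
   positions (the smallest number is dual).  A jump of length [n] increases or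
   decreases the position according to the number of ones jumped over.  As in
   the three gap theorem, if [d] and [u] are the shortest decreasing and
   increasing jumps inside [H], the first returns to [H] are [d], [u] and
   [u + d].

   Conversely, as long as [w] looks Sturmian its occurrences of a bispecial
   factor [p] cut it into two kinds of blocks [X] and [Y], and either [p] can be
   replaced by a longer factor or both [XX] and [YY] occur.  In the latter case,
   exchanging [X] and [Y] if necessary, there are three gaps between consecutive
   blocks [Y].  The ends of the blocks [Y] are the starting points of the heavy
   windows of length [|X|].  At the end of a long repetition at distance [n] one
   copy continues with [X] and the other one with [Y], and for windows of length
   [n + |X|] this merges two consecutive gaps into a fourth abelian return. *)

(** * Recurrent binary words *)

Section Agreement.
Variables (T : Type) (v : nat -> T).

Definition agree i j n := forall t, t < n -> v (i + t) = v (j + t).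

Definition recurrent_word := forall i n N, exists2 j, N <= j & agree j i n.

Lemma agree_sym i j n : agree i j n -> agree j i n.
Proof. by move=> h t tn; rewrite h. Qed.

Lemma agree_trans j i k n : agree i j n -> agree j k n -> agree i k n.
Proof. by move=> h h' t tn; rewrite h ?h'. Qed.

Lemma agree_sub i j n d m : agree i j n -> d + m <= n ->
  agree (i + d) (j + d) m.
Proof. by move=> h le t tm; rewrite -!addnA h //; lia. Qed.

End Agreement.

Section Blocks.
Variables (A : finType) (w : nat -> A).

Lemma size_block i n : size (block w i n) = n.
Proof. by rewrite size_map size_iota. Qed.

Lemma blockS i n : block w i n.+1 = rcons (block w i n) (w (i + n)).
Proof. by rewrite /block -addn1 iotaD map_cat cats1. Qed.

Lemma block_agree i j n : block w i n = block w j n <-> agree w i j n.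
Proof.
split=> [E t tn|h]; last first.
  apply: (@eq_from_nth _ (w 0)) => [|t]; rewrite !size_block // => tn.
  by rewrite !(nth_map 0) ?size_iota // !nth_iota // h.
have := congr1 (fun s => nth (w 0) s t) E.
by rewrite !(nth_map 0) ?size_iota // !nth_iota.
Qed.

End Blocks.

Section BinaryWord.
Variable v : nat -> bool.

Definition cnt (c : bool) i n := count_mem c (block v i n).

Lemma cntD c i m n : cnt c i (m + n) = cnt c i m + cnt c (i + m) n.
Proof. by rewrite /cnt /block iotaD map_cat count_cat. Qed.

Lemma cnt0 c i : cnt c i 0 = 0.
Proof. by []. Qed.

Lemma cnt1 c i : cnt c i 1 = (v i == c).
Proof. by rewrite /cnt /= addn0. Qed.

Lemma cntS c i n : cnt c i n.+1 = (v i == c) + cnt c i.+1 n.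
Proof. by rewrite -add1n cntD cnt1 addn1. Qed.

Lemma cntSr c i n : cnt c i n.+1 = cnt c i n + (v (i + n) == c).
Proof. by rewrite -addn1 cntD cnt1. Qed.

Lemma cntC c i n : cnt c i n + cnt (~~ c) i n = n.
Proof.
elim: n i => [|n IH] i; first by rewrite !cnt0.
move: (IH i.+1) => {IH}; rewrite !cntS.
by case: (v i); case: c => /=; lia.
Qed.

Lemma eq_cnt c i j n : agree v i j n -> cnt c i n = cnt c j n.
Proof.
elim: n i j => [|n IH] i j h; first by rewrite !cnt0.
rewrite !cntS (IH i.+1 j.+1) => [|t tn]; last by rewrite !addSnnS h.
by move: (h 0 isT); rewrite !addn0 => ->.
Qed.

Lemma cnt_slide c i n :
  cnt c i n + (v (i + n) == c) = (v i == c) + cnt c i.+1 n.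
Proof. by rewrite -cntSr cntS. Qed.

Definition aperiodic_word := forall T, 0 < T -> exists n, v (n + T) != v n.

Definition balanced_word := forall m i j, agree v i.+1 j.+1 m ->
  ~ [/\ v i = false, v (i.+1 + m) = false, v j = true & v (j.+1 + m) = true].

Hypothesis rec_v : recurrent_word v.
Hypothesis ape_v : aperiodic_word.

Lemma aperiodic_after T N : 0 < T -> exists2 k, N <= k & v (k + T) != v k.
Proof.
move=> T0; have [k hk] := ape_v T0.
have [j Nj h] := rec_v k T.+1 N; exists j => //.
by move: (h 0 isT) (h T (ltnSn T)); rewrite !addn0 => -> ->.
Qed.

(* Both orders of the two diverging copies of a prefix are available because
   the prefix followed by either letter recurs. *)
Lemma diverging_prefix M c : exists i n e,
  [/\ 0 < n, M <= e, agree v i 0 e, agree v (i + n) 0 e &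
      v (i + e) = c /\ v (i + n + e) = ~~ c].
Proof.
have [n n0 hn] := rec_v 0 M 1.
have ex : exists k, v (k + n) != v k by apply: ape_v.
case: (ex_minnP ex) => e ve emin.
have ag : agree v n 0 e.
  move=> t te; rewrite add0n addnC; apply/eqP/negPn/negP => /emin; lia.
have Me : M <= e.
  rewrite leqNgt; apply/negP => eM; move: ve.
  by rewrite addnC hn // add0n eqxx.
(* If the prefix itself continues with [c], the copies at [0] and [n] serve. Otherwise the copy at
   [n] continues with [c], and a later copy of the first [e.+1] letters continues with [~~ c]. *)
have [vc|vc] := eqVneq (v e) c.
  exists 0, n, e; split=> //; rewrite !add0n; split=> //.
  by move: ve; rewrite addnC vc; case: (v _) c {vc} => [] [].
have [j jn hj] := rec_v 0 e.+1 n.+1.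
exists n, (j - n), e; have -> : n + (j - n) = j by lia.
split=> //; first by lia.
  by move=> t te; apply: hj; lia.
split; last by rewrite hj // add0n; case: (v e) c vc => [] [].
by move: ve vc; rewrite addnC; case: (v _) => //; case: (v _) c => [] [].
Qed.

End BinaryWord.

Section Counting.
Variable v : nat -> bool.
Hypothesis bal : balanced_word v.
Local Notation cnt := (cnt v true).

(** Induction on the length. If the counts differ by two, the windows start with [true] and [false].
    At the next disagreement the same two letters give 1z1 and 0z0, and the opposite ones leave
    shorter windows whose counts differ by two. *)
Lemma balanced_cnt n i j : cnt i n <= (cnt j n).+1.
Proof.
have [k] := ubnP n; elim: k n i j => // k IH n i j nk.
rewrite leqNgt; apply/negP => gt2.
case: n => [|n] in nk gt2 *; first by rewrite !cnt0 in gt2.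
have n_lt : n < k by lia.
have IHn i' j' : cnt i' n <= (cnt j' n).+1 by apply: IH.
move: (IHn i.+1 j.+1) (gt2); rewrite !cntS => h1 h2.
have vi : v i = true by move: h2; case: (v i) (v j) => [] []; lia.
have vj : v j = false by move: h2; rewrite vi; case: (v j); lia.
have eqc : cnt i.+1 n = (cnt j.+1 n).+1 by move: h2; rewrite vi vj /=; lia.
have ex : exists t, (t < n) && (v (i.+1 + t) != v (j.+1 + t)).
  apply: contrapT => none; suff e : cnt i.+1 n = cnt j.+1 n by lia.
  apply: eq_cnt => t tn; apply/eqP/negPn/negP => ne; apply: none.
  by exists t; rewrite tn.
case: (ex_minnP ex) => t /andP[tn vt] tmin.
have ag : agree v i.+1 j.+1 t.
  move=> s st; apply/eqP/negPn/negP => ne.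
  by have := tmin s; rewrite ne (ltn_trans st tn) => /(_ isT); lia.
have [r nr] : exists r, n = t + r.+1 by exists (n - t.+1); lia.
have rk : r < k by lia.
have := IH r (i.+1 + t).+1 (j.+1 + t).+1 rk; move: eqc.
rewrite nr !cntD (eq_cnt _ ag) !cntS.
case vit: (v (i.+1 + t)); case vjt: (v (j.+1 + t)) => /=; try lia.
  move=> _ _; apply: (bal (agree_sym ag)); split=> //.
Qed.

End Counting.

(** * Blocks between occurrences of a bispecial factor *)

Lemma neqb (a b : bool) : a != b -> a = ~~ b.
Proof. by case: a b => [] []. Qed.

Lemma neqC (a b : bool) : a != ~~ b -> a = b.
Proof. by case: a b => [] []. Qed.

Lemma step_arith (m x qe ac ce ae y : nat) : x = m + y -> ac + m + ce = qe ->
  ce + (ae + x) = qe - ac + ae + y.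
Proof. by move=> -> <-; lia. Qed.

Section Stages.
Variable v : nat -> bool.
Hypothesis rec_v : recurrent_word v.
Hypothesis ape_v : aperiodic_word v.
Local Notation cnt := (cnt v).
Local Notation agree := (agree v).

(** A finite word is encoded as a function [p] with a length [l]; only the values of [p] below [l]
    matter. *)
Definition occ (p : nat -> bool) l i := [forall t : 'I_l, v (i + t) == p t].

Lemma occP p l i : reflect (forall t, t < l -> v (i + t) = p t) (occ p l i).
Proof.
apply: (iffP forallP) => [h t tl|h t]; last by rewrite h.
by have /eqP := h (Ordinal tl).
Qed.

Lemma occ_agree p l i j : agree i j l -> occ p l i = occ p l j.
Proof. by move=> h; apply/occP/occP => o t tl; rewrite -o // h. Qed.

(* Occurrences of [p] cut the word into blocks.  A block has the type [c] of
   the letter that follows the occurrence of [p] at its beginning; it has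
   length [q c] and ends with [c].  A window of length [q (~~ c)] has [a c]
   letters [c], and one more exactly if [cp] occurs at its beginning. *)
Record stage (p : nat -> bool) (l : nat) (q a : bool -> nat) := Stage {
  stage_pos : forall c, 0 < q c;
  stage_len : l + 2 = q true + q false;
  stage_occ : exists i, occ p l i;
  stage_next : forall i, occ p l i -> occ p l (i + q (v (i + l)));
  stage_gap : forall i k, occ p l i -> i < k < i + q (v (i + l)) ->
    ~~ occ p l k;
  stage_prev : forall i, occ p l i -> v (i + q (v (i + l))).-1 = v (i + l);
  stage_cnt : forall c j,
    cnt c j (q (~~ c)) = a c + ((v j == c) && occ p l j.+1);
  stage_bal : forall m i j, agree i.+1 j.+1 m ->
    [/\ v i = false, v (i.+1 + m) = false, v j = true & v (j.+1 + m) = true] ->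
    l <= m }.

(** The empty factor occurs everywhere and cuts the word into single letters. *)
Lemma stage0 : stage (fun=> false) 0 (fun=> 1) (fun=> 0).
Proof.
have occ0 i : occ (fun=> false) 0 i by apply/occP.
split=> //.
- by exists 0.
- by move=> i k; lia.
- by move=> i _; rewrite addn1 /= addn0.
- by move=> c j; rewrite occ0 andbT cnt1 add0n.
Qed.

Section Stage.
Variables (p : nat -> bool) (l : nat) (q a : bool -> nat).
Hypothesis st : stage p l q a.
Local Notation pocc := (occ p l).
Local Notation type i := (v (i + l)).

Lemma stage_lenc c : l + 2 = q c + q (~~ c).
Proof. by rewrite (stage_len st); case: c; rewrite // addnC. Qed.

Lemma stage_qle c : q c <= l.+1.
Proof. by have := stage_lenc c; have := stage_pos st (~~ c); lia. Qed.

Lemma last_occ i k : pocc i -> i <= k ->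
  exists b, [/\ i <= b <= k, pocc b & k < b + q (type b)].
Proof.
move=> oi ik; have ex : exists b, (b <= k) && pocc b by exists i; rewrite ik.
have bd b : (b <= k) && pocc b -> b <= k by case/andP.
case: (ex_maxnP ex bd) => b /andP[bk ob] bmax; exists b; split=> //.
  by rewrite bk andbT; apply: bmax; rewrite ik.
rewrite ltnNge; apply/negP => kb.
have := bmax (b + q (type b)); rewrite kb (stage_next st ob) => /(_ isT).
by have := stage_pos st (type b); lia.
Qed.

Lemma prev_occ i k : pocc i -> pocc k -> i < k ->
  exists b, [/\ i <= b, b < k, pocc b, k = b + q (type b) & v k.-1 = type b].
Proof.
move=> oi ok ik; have [|b [/andP[ib bk] ob kb]] := @last_occ i k.-1 oi;
  first lia.
have kE : k = b + q (type b).
  apply/eqP; rewrite eqn_leq; apply/andP; split; first lia.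
  rewrite leqNgt; apply/negP => lt.
  by have := stage_gap st ob (k := k); rewrite lt ok; lia.
exists b; split=> //; first by lia.
by rewrite {1}kE (stage_prev st).
Qed.

(** If the last occurrence of [p] starting by [e - l] began earlier, the next one would be the same
    in both copies and would cover position [e], forcing equal letters there. *)
Lemma diverging_occ i0 e i j : pocc i0 -> i0 + l <= e ->
  agree i 0 e -> agree j 0 e -> v (i + e) != v (j + e) -> pocc (e - l).
Proof.
move=> oi0 le hi hj ne.
have [|b [/andP[_ be] ob lt]] := @last_occ i0 (e - l) oi0; first lia.
have [<-//|bne] := eqVneq b (e - l).
have ble : b + l < e by lia.
have cp k : agree k 0 e ->
    pocc (k + b + q (type b)) /\ v (k + e) = p (e - (b + q (type b))).
  move=> hk.
  have okb : pocc (k + b).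
    rewrite (occ_agree _ (j := b)) // -[X in agree _ X]add0n.
    by apply: agree_sub hk _; lia.
  have tkb : type (k + b) = type b by rewrite -addnA hk.
  have := stage_next st okb; rewrite tkb => o; split=> //.
  have qe := stage_qle (type b).
  have -> : k + e = k + b + q (type b) + (e - (b + q (type b))) by lia.
  by move/occP: o; apply; lia.
by case/eqP: ne; rewrite (cp i hi).2 (cp j hj).2.
Qed.

(** Both copies of a diverging prefix have [p] just before the divergence, so [p] is right
    special. *)
Lemma occ_of_type c : exists2 i, pocc i & type i = c.
Proof.
have [i0 oi0] := stage_occ st.
have [i [n [e [n0 le hi hj [vi vj]]]]] :=
  diverging_prefix rec_v ape_v (i0 + l) c.
have ne : v (i + e) != v (i + n + e) by rewrite vi vj; case: (c).
have ob := diverging_occ oi0 le hi hj ne; exists (i + (e - l)).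
  rewrite (occ_agree _ (j := e - l)) // -[X in agree _ X]add0n.
  by apply: agree_sub hi _; lia.
by rewrite -vi; congr v; lia.
Qed.

Lemma occ_preceded c : exists i, v i = c /\ pocc i.+1.
Proof.
have [i oi tc] := occ_of_type c.
have := stage_pos st c => q0.
exists (i + q c).-1; rewrite prednK; last lia.
by have := stage_next st oi; have := stage_prev st oi; rewrite tc.
Qed.

(** At the last mismatch with [p], opposite letters precede a common word z shorter than [l]. One of
    the diverging copies and an occurrence of [p] with a suitable next letter then read 0z0 and 1z1,
    against [stage_bal]. *)
Lemma right_special_occ m i j : agree i j m -> v (i + m) != v (j + m) ->
  l <= m -> pocc (i + m - l).
Proof.
move=> hm ne lm.
wlog {ne} [vi vj] : i j hm / v (i + m) = false /\ v (j + m) = true.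
  move=> W; case vi: (v (i + m)) ne; case vj: (v (j + m)) => // _.
    rewrite (occ_agree _ (j := j + m - l)); first exact: (W j i (agree_sym hm)).
    by rewrite -!addnBA //; apply: agree_sub hm _; lia.
  exact: (W i j).
apply: contrapT => no.
have ex : exists t, (t < l) && (v (i + m - t.+1) != p (l - t.+1)).
  apply: contrapT => none; apply: no; apply/occP => t tl.
  apply/eqP/negPn/negP => ne; apply: none; exists (l - t.+1).
  have -> : i + m - (l - t.+1).+1 = i + m - l + t by lia.
  have -> : l - (l - t.+1).+1 = t by lia.
  by rewrite ne andbT; lia.
case: (ex_minnP ex) => t /andP[tl vt] tmin.
have sm s : s < t -> v (i + m - s.+1) = p (l - s.+1).
  move=> s_t; apply/eqP/negPn/negP => ne.
  by have := tmin s; rewrite ne (ltn_trans s_t tl) => /(_ isT); lia.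
have [x ox tx] := occ_of_type (~~ v (i + m - t.+1)).
have agx k : agree k i m -> agree (k + m - t) (x + l - t) t.
  move=> hk s st'; have /occP/(_ (l - t + s)) := ox.
  have -> : x + (l - t + s) = x + l - t + s by lia.
  move=> ->; last lia.
  have -> : k + m - t + s = k + (m - t + s) by lia.
  rewrite hk; last lia.
  have := sm (t - s.+1).
  have -> : l - (t - s.+1).+1 = l - t + s by lia.
  have -> : i + m - (t - s.+1).+1 = i + (m - t + s) by lia.
  by apply; lia.
have vx : v (x + l - t.+1) = ~~ v (i + m - t.+1).
  have /occP/(_ (l - t.+1)) := ox.
  have -> : x + (l - t.+1) = x + l - t.+1 by lia.
  by move=> ->; [case: (v _) (p _) vt => [] [] | lia].
have vij : v (i + m - t.+1) = v (j + m - t.+1).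
  by rewrite -!addnBA ?(leq_trans tl) // hm //; move: tl lm; clear; lia.
suff : l <= t by rewrite leqNgt tl.
have pr k : t < k -> (k - t.+1).+1 = k - t by clear; lia.
case vit: (v (i + m - t.+1)) vx tx => /= vx tx.
- apply: (stage_bal st (i := x + l - t.+1) (j := j + m - t.+1)).
    by rewrite !pr; [apply/agree_sym/agx/agree_sym | move: tl lm; clear; lia..].
  split=> //; last 2 first.
  + by rewrite -vij.
  + by rewrite -vj; congr v; move: tl lm; clear; lia.
  by rewrite -tx; congr v; move: tl lm; clear; lia.
- apply: (stage_bal st (i := i + m - t.+1) (j := x + l - t.+1)).
    by rewrite !pr; [apply/agx | move: tl lm; clear; lia..].
  split=> //.
  + by rewrite -vi; congr v; move: tl lm; clear; lia.
  + by rewrite -tx; congr v; move: tl lm; clear; lia.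
Qed.

(** Mirror image of [right_special_occ], with [occ_preceded] in place of [occ_of_type]. *)
Lemma left_special_occ m i j : agree i.+1 j.+1 m -> v i != v j ->
  l <= m -> pocc i.+1.
Proof.
move=> hm ne lm.
wlog {ne} [vi vj] : i j hm / v i = false /\ v j = true.
  move=> W; case vi: (v i) ne; case vj: (v j) => // _.
    rewrite (occ_agree _ (j := j.+1)); first exact: (W j i (agree_sym hm)).
    by move=> t tl; apply: hm; lia.
  exact: (W i j).
apply: contrapT => no.
have ex : exists t, (t < l) && (v (i.+1 + t) != p t).
  apply: contrapT => none; apply: no; apply/occP => t tl.
  by apply/eqP/negPn/negP => ne; apply: none; exists t; rewrite ne tl.
case: (ex_minnP ex) => t /andP[tl vt] tmin.
have sm s : s < t -> v (i.+1 + s) = p s.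
  move=> s_t; apply/eqP/negPn/negP => ne.
  by have := tmin s; rewrite ne (ltn_trans s_t tl) => /(_ isT); lia.
have [x [vx ox]] := occ_preceded (~~ v (i.+1 + t)).
have agx : agree i.+1 x.+1 t.
  by move=> s st'; rewrite sm //; move/occP: ox => -> //; lia.
have vxt : v (x.+1 + t) = ~~ v (i.+1 + t).
  by move/occP: ox => -> //; case: (v _) (p _) vt => [] [].
have vij : v (i.+1 + t) = v (j.+1 + t) by apply: hm; apply: leq_trans lm.
suff : l <= t by rewrite leqNgt tl.
case vit: (v (i.+1 + t)) vx vxt => /= vx vxt.
- apply: (stage_bal st (i := x) (j := j)); last by rewrite -vij.
  by move=> s s_t; rewrite -agx // hm // (ltn_trans s_t) // (leq_trans tl).
- by apply: (stage_bal st (i := i) (j := x)).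
Qed.

(** * Prolonging the bispecial factor *)

Section Step.
Variable c : bool.
Hypothesis absent : forall j, v j = c -> pocc j.+1 -> type j.+1 = ~~ c.
Local Notation e := (~~ c).
Variable i0 : nat.
Hypotheses (oi0 : pocc i0) (ti0 : type i0 = e).
(** [p'] is the block of type [e] at [i0] followed by [p]; it occurs exactly where [p] starts a
    block of type [e]. By [absent] a block of type [c] is always followed by one of type [e], so the
    new blocks are an [e] block alone or an [e] block followed by a [c] block. *)
Let p' t := v (i0 + t).
Let l' := l + q e.
Let q' b := if b == c then q c + q e else q e.
Let a' b := if b == c then a c else q e - a c + a e.

Let q'c : q' c = q c + q e. Proof. by rewrite /q' eqxx. Qed.
Let q'e : q' e = q e. Proof. by rewrite /q'; case: (c). Qed.
Let l'E i : i + l' = i + q e + l. Proof. by rewrite /l'; lia. Qed.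

Let occE i : occ p' l' i = pocc i && (type i == e).
Proof.
have q0 := stage_pos st e; have qle := stage_qle e.
apply/occP/andP => [h|[oi /eqP ti] t tl].
  split; last by rewrite h; [rewrite /p' ti0 | rewrite /l'; lia].
  apply/occP => t tl; rewrite h /p' /l'; last lia.
  by move/occP: oi0; apply.
have /occP ok := stage_next st oi; have /occP ok0 := stage_next st oi0.
move: ok ok0; rewrite ti ti0 => ok ok0.
move/occP: oi => oi; have /occP oi0' := oi0.
rewrite /p'; case: (ltngtP t l) => [lt|lt|->]; last by rewrite ti ti0.
  by rewrite oi ?oi0'.
have -> : t = q e + (t - q e) by lia.
by rewrite !addnA ok ?ok0 //; rewrite /l' in tl; lia.
Qed.

Let step_next i : occ p' l' i -> occ p' l' (i + q' (v (i + l'))).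
Proof.
rewrite l'E !occE => /andP[oi /eqP ti].
have ok := stage_next st oi; rewrite ti in ok.
have [tk|tk] := eqVneq (type (i + q e)) e; first by rewrite tk q'e ok tk eqxx.
have {}tk : type (i + q e) = c by apply: neqC.
have ok' := stage_next st ok; rewrite tk in ok'.
have -> : i + q' (type (i + q e)) = i + q e + q c by rewrite tk q'c; lia.
rewrite ok'; apply/eqP.
have pk := stage_prev st ok; rewrite tk in pk.
have q0 := stage_pos st c.
have E : (i + q e + q c).-1.+1 = i + q e + q c by move: q0; clear; lia.
by rewrite -E; apply: absent; rewrite ?E.
Qed.

Let step_gap i k : occ p' l' i -> i < k < i + q' (v (i + l')) -> ~~ occ p' l' k.
Proof.
rewrite l'E !occE => /andP[oi /eqP ti] /andP[ik].
have ok := stage_next st oi; rewrite ti in ok.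
have gi m : i < m < i + q e -> ~~ pocc m.
  by move=> h; apply: (stage_gap st oi); rewrite ti.
have [tk|tk] := eqVneq (type (i + q e)) e.
  by rewrite tk q'e => kq; rewrite (negbTE (gi k _)) // ik.
have {}tk : type (i + q e) = c by apply: neqC.
rewrite tk q'c => kq; case: (ltngtP k (i + q e)) => [lt|lt|->].
- by rewrite (negbTE (gi k _)) // ik.
- rewrite (negbTE (stage_gap st ok (k := k) _)) // tk; lia.
- by rewrite tk; case: (c); rewrite andbF.
Qed.

Let step_prev i : occ p' l' i -> v (i + q' (v (i + l'))).-1 = v (i + l').
Proof.
rewrite l'E !occE => /andP[oi /eqP ti].
have ok := stage_next st oi; rewrite ti in ok.
have [tk|tk] := eqVneq (type (i + q e)) e.
  by have := stage_prev st oi; rewrite ti tk q'e.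
have {}tk : type (i + q e) = c by apply: neqC.
have := stage_prev st ok; rewrite tk => {2}<-.
by rewrite q'c; congr (v _.-1); lia.
Qed.

(** The left side says that a block of type [e] starts at [j.+1]. The right side distinguishes the
    letter before this block; after [c] the type [e] is forced by [absent]. *)
Let step_marks j : (v (j + q e) == e) && pocc (j + q e).+1
  = ((v j == c) && pocc j.+1) + ((v j == e) && occ p' l' j.+1) :> nat.
Proof.
have q0 := stage_pos st e.
(* A later copy of the neighbourhood of [j] lies after [i0], as [prev_occ] requires. *)
wlog ij : j / i0 < j.
  have [k ik h] := rec_v j (l' + 2 + q e) i0.+1; move/(_ k ik).
  have vk t : t < l' + 2 + q e -> v (k + t) = v (j + t) by exact: h.
  have ok t n : t + n <= l' + 1 + q e -> agree (k + t).+1 (j + t).+1 n.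
    by move=> le; rewrite -!addnS; apply: agree_sub h _; lia.
  have vk0 : v k = v j by have := vk 0; rewrite !addn0; apply; lia.
  have qe : q e < l' + 2 + q e by clear; lia.
  have lq : q e + l <= l' + 1 + q e by rewrite /l'; clear; lia.
  rewrite (vk _ qe) vk0 (occ_agree _ (ok (q e) l lq)).
  have := ok 0; rewrite !addn0 => ok0.
  by rewrite !(occ_agree _ (ok0 _ _)) //; rewrite ?/l'; clear; lia.
rewrite occE.
have -> : (v (j + q e) == e) && pocc (j + q e).+1 =
          pocc j.+1 && (type j.+1 == e).
  apply/andP/andP => [[/eqP ve o]|[o /eqP te]].
    have [|b [_ _ ob E ve']] := prev_occ oi0 o; first lia.
    move: ve'; rewrite /= ve => tb; rewrite -tb in E.
    have <- : b = j.+1 by lia.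
    by rewrite ob -tb.
  have := stage_next st o; have := stage_prev st o; rewrite te addSn => ve o'.
  by split=> //; apply/eqP.
case o: (pocc j.+1); rewrite ?andbF //=.
case: (eqVneq (v j) c) => [vj|/neqb->]; last by rewrite eqxx.
by rewrite vj absent // eqxx; case: (c).
Qed.

(** For [b = e] the window is cut after [q e] letters. The mark of [c] that is subtracted in the
    first part is regained in the second one by [step_marks]. *)
Let step_cnt b j :
  cnt b j (q' (~~ b)) = a' b + ((v j == b) && occ p' l' j.+1).
Proof.
have [->|] := eqVneq b c.
  rewrite q'e (stage_cnt st) /a' eqxx occE; congr (_ + nat_of_bool _).
  case o: (pocc j.+1); rewrite ?andbF //=.
  case: eqP => //= vj; by rewrite absent ?eqxx.
move/neqb->.
rewrite negbK q'c addnC cntD.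
have -> : a' e = q e - a c + a e by rewrite /a'; case: (c).
have := stage_cnt st e (j + q e); rewrite negbK => ->.
have := cntC v c j (q e); rewrite (stage_cnt st).
by apply: step_arith; apply: step_marks.
Qed.

(** The common word z starts and ends with [p]. In czc the first [p] starts a block of type [e], and
    z is not [p] itself, so the last [p] begins at least [q e] later. *)
Let step_bal m i j : agree i.+1 j.+1 m ->
  [/\ v i = false, v (i.+1 + m) = false, v j = true & v (j.+1 + m) = true] ->
  l' <= m.
Proof.
move=> h hv; have lm := stage_bal st h hv; case: hv => vi vim vj vjm.
have oj1 : pocc j.+1.
  by apply: (left_special_occ (agree_sym h)); rewrite ?vi ?vj.
have oi1 : pocc i.+1 by apply: (left_special_occ h); rewrite ?vi ?vj.
have oim : pocc (i.+1 + m - l) by apply: (right_special_occ h);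
  rewrite ?vim ?vjm.
have ojm : pocc (j.+1 + m - l).
  by apply: (right_special_occ (agree_sym h)); rewrite ?vim ?vjm.
have [x [vx vxm ox oxm]] : exists x,
    [/\ v x = c, v (x.+1 + m) = c, pocc x.+1 & pocc (x.+1 + m - l)].
  by case: (c); [exists j | exists i].
have tx := absent vx ox.
rewrite leqNgt; apply/negP => ml.
have [E|ne] := eqVneq m l; first by move: vxm; rewrite E tx; case: (c).
have := stage_gap st ox (k := x.+1 + m - l); rewrite oxm tx => /(_ _)/negP;
  apply=> //.
by move: ml ne lm; rewrite /l'; clear; lia.
Qed.

Lemma stage_step : exists p1 l1 q1 a1, stage p1 l1 q1 a1 /\ l < l1.
Proof.
exists p', l', q', a'; split; last by have := stage_pos st e; rewrite /l'; lia.
split=> //.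
- by move=> b; have := stage_pos st c; have := stage_pos st e; rewrite /q';
  case: eqP; lia.
- have := stage_lenc c.
  have -> : q' true + q' false = q' c + q' e by case: (c); rewrite // addnC.
  by rewrite q'c q'e /l'; lia.
- by exists i0; rewrite occE oi0 ti0 eqxx.
Qed.

End Step.
End Stage.

(* By [stage_step] the length [l] is then unbounded. *)
Lemma stages_balanced :
  (forall p l q a, stage p l q a ->
     exists c, forall j, v j = c -> occ p l j.+1 -> v (j.+1 + l) = ~~ c) ->
  balanced_word v.
Proof.
move=> absent m i j h hv.
have [p [l [q [a [st ml]]]]] : exists p l q a, stage p l q a /\ m < l.
  elim: (m) => [|n [p [l [q [a [st nl]]]]]].
    have [c hc] := absent _ _ _ _ stage0.
    have [i0 o t] := occ_of_type stage0 (~~ c).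
    by have [p [l [q [a [st l0]]]]] := stage_step stage0 hc o t;
      exists p, l, q, a.
  have [c hc] := absent _ _ _ _ st.
  have [i0 o t] := occ_of_type st (~~ c).
  have [p' [l' [q' [a' [st' ll]]]]] := stage_step st hc o t.
  by exists p', l', q', a'; split=> //; lia.
by have := stage_bal st h hv; lia.
Qed.

End Stages.

(** * Abelian returns of an unbalanced word *)

Section Returns.
Variable v : nat -> bool.
Local Notation cnt := (cnt v).

Definition areturn c s K m n :=
  [/\ m < n, cnt c m s = K, cnt c n s = K &
      forall k, m < k < n -> cnt c k s <> K].

(** Over two letters, the length and the number of letters [c] determine the abelian class. *)
Definition rclass c m n := (n - m, cnt c m (n - m)).

Definition few_returns := forall s K m1 n1 m2 n2 m3 n3 m4 n4,
  areturn true s K m1 n1 -> areturn true s K m2 n2 ->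
  areturn true s K m3 n3 -> areturn true s K m4 n4 ->
  ~~ uniq [:: rclass true m1 n1; rclass true m2 n2; rclass true m3 n3;
    rclass true m4 n4].

Lemma areturn_true c s K m n :
  areturn c s K m n -> areturn true s (if c then K else s - K) m n.
Proof.
case: c => // -[mn hm hn h].
have E k : cnt true k s = s - cnt false k s by have := cntC v true k s => /=;
  clear; lia.
split; rewrite ?E ?hm ?hn // => k km; rewrite E.
have := h k km; have := cntC v true k s; have := cntC v true m s => /=.
by rewrite hm; clear; lia.
Qed.

Lemma few_returnsC c : few_returns -> forall s K m1 n1 m2 n2 m3 n3 m4 n4,
  areturn c s K m1 n1 -> areturn c s K m2 n2 ->
  areturn c s K m3 n3 -> areturn c s K m4 n4 ->
  ~~ uniq [:: rclass c m1 n1; rclass c m2 n2; rclass c m3 n3; rclass c m4 n4].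
Proof.
move=> few s K m1 n1 m2 n2 m3 n3 m4 n4 r1 r2 r3 r4.
have := few _ _ _ _ _ _ _ _ _ _ (areturn_true r1) (areturn_true r2)
  (areturn_true r3) (areturn_true r4).
apply: contra => u; apply: (@map_uniq _ _ (fun x =>
  (x.1, if c then x.2 else x.1 - x.2))).
rewrite [X in uniq X](_ : _ = [:: rclass c m1 n1; rclass c m2 n2;
  rclass c m3 n3; rclass c m4 n4]) //.
rewrite /= /rclass; case: (c) => //=.
have E m n : n - m - cnt true m (n - m) = cnt false m (n - m).
  by have := cntC v true m (n - m) => /=; clear; lia.
by rewrite !E.
Qed.

Hypothesis rec_v : recurrent_word v.
Hypothesis ape_v : aperiodic_word v.
Hypothesis few : few_returns.
Local Notation agree := (agree v).

Section Stage.
Variables (p : nat -> bool) (l : nat) (q a : bool -> nat).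
Hypothesis st : stage v p l q a.
Local Notation occ := (occ v p l).
Local Notation type i := (v (i + l)).

(** After a first occurrence of [p], marks are the last positions of the blocks of type [c]. By
    [stage_cnt] they are also the starts of the windows of length [q (~~ c)] with the larger number
    of letters [c]. *)
Definition mark c k := (v k == c) && occ k.+1.

Lemma mark_agree c i j n t : agree i j n -> t + l < n ->
  mark c (i + t) = mark c (j + t).
Proof.
move=> h tn; rewrite /mark h; last by move: tn; clear; lia.
congr (_ && _); apply: occ_agree; rewrite -!addnS; apply: agree_sub h _.
by move: tn; clear; lia.
Qed.

Lemma mark_after c i N : mark c i -> exists2 k, N <= k & mark c k.
Proof.
move=> mi; have [j Nj h] := rec_v i l.+1 N; exists j => //.
by rewrite -[j]addn0 (mark_agree _ h) ?addn0.
Qed.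

Definition mark_return c m d :=
  [/\ 0 < d, mark c m, mark c (m + d) & forall k, m < k < m + d -> ~~ mark c k].

(** A block of type [c] would end with a mark, so all blocks from [x] to [y] have type [~~ c]. *)
Lemma occ_run c x y : occ x -> occ y -> x <= y ->
  (forall k, x <= k < y -> ~~ mark c k) -> exists b, y = x + b * q (~~ c).
Proof.
have [n] := ubnP (y - x); elim: n y => // n IH y yn ox oy xy nm.
have [->|ne] := eqVneq y x; first by exists 0; rewrite addn0.
have lt : x < y by rewrite ltn_neqAle eq_sym ne.
have [b [xb b_y ob E vy]] := prev_occ st ox oy lt.
have tb : type b = ~~ c.
  have := nm y.-1; rewrite /mark prednK ?(leq_ltn_trans _ lt) // oy andbT vy.
  by move=> H; apply: neqb; apply: H; move: lt; clear; lia.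
have [||k kE] := IH b _ ox ob xb; first by move: yn b_y xb; clear; lia.
  by move=> k /andP[xk kb]; apply: nm; rewrite xk (ltn_trans kb).
by exists k.+1; rewrite E tb kE mulSn; clear; lia.
Qed.

(** The mark ends a block of type [c] that comes after the block of type [~~ c] at [x], and the two
    lengths add up to [l + 2]. *)
Lemma next_mark c x y : occ x -> type x = ~~ c -> mark c y -> x <= y ->
  x + l.+1 <= y.
Proof.
move=> ox tx /andP[/eqP vy oy] xy;
  have [b [xb bY ob E vb]] := prev_occ st ox oy xy.
have bx : x != b by apply/eqP => xE; move: vb; rewrite -xE tx /= vy; case: (c).
have := stage_gap st ox (k := b); rewrite ob tx ltn_neqAle bx xb /= => g.
have xqb : x + q (~~ c) <= b by rewrite leqNgt; apply/negP => /g.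
have tb : type b = c by rewrite -vb.
have := stage_lenc st c; move: E xqb; rewrite tb; clear; lia.
Qed.

Lemma mark_next c x : occ x -> type x = c ->
  mark c (x + q c).-1 /\ forall k, x <= k < (x + q c).-1 -> ~~ mark c k.
Proof.
move=> ox tx; have q0 := stage_pos st c.
have E : (x + q c).-1.+1 = x + q c by move: q0; clear; lia.
split; rewrite /mark.
  by rewrite E; have := stage_next st ox; have := stage_prev st ox;
    rewrite tx => -> ->; rewrite eqxx.
move=> k /andP[xk kq]; rewrite negb_and (stage_gap st ox) ?orbT // tx ltnS xk.
by move: kq; clear; lia.
Qed.

(** A gap between consecutive marks is a run of blocks of type [~~ c] and then one block of type
    [c]. *)
Lemma mark_return_length c m d : mark_return c m d ->
  exists b, d = q c + b * q (~~ c).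
Proof.
case=> d0 /andP[_ om] /andP[/eqP vmd omd] nm.
have [|b [mb bl ob E vb]] := prev_occ st om omd; first by move: d0; clear; lia.
have tb : type b = c by rewrite -vb.
have [|k kE] := occ_run (c := c) om ob mb.
  by move=> k hk; apply: nm; move: hk bl; clear; lia.
by exists k; move: E; rewrite tb kE; clear; lia.
Qed.

Lemma cnt_run c x b : cnt c x (b * q (~~ c)) =
  b * a c + \sum_(h < b) mark c (x + h * q (~~ c)).
Proof.
elim: b => [|b IH]; first by rewrite big_ord0 cnt0.
by rewrite mulSnr cntD IH (stage_cnt st) big_ord_recr mulSnr /mark /=; clear;
  lia.
Qed.

(** Since [q c <= l.+1], both windows are the same prefix of [c] followed by [p]. *)
Lemma cnt_mark c m m' : mark c m -> mark c m' -> cnt c m (q c) = cnt c m' (q c).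
Proof.
move=> /andP[/eqP vm /occP om] /andP[/eqP vm' /occP om'].
apply: eq_cnt => -[|t] tq; first by rewrite !addn0 vm.
have tl : t < l by have := stage_qle st c; move: tq; clear; lia.
by rewrite !addnS -!addSn om ?om'.
Qed.

Lemma cnt_mark_return c m b : mark_return c m (q c + b * q (~~ c)) ->
  cnt c m (q c + b * q (~~ c)) = cnt c m (q c) + b * a c.
Proof.
case=> _ _ _ nm; rewrite cntD cnt_run big1 ?addn0 // => h _.
have -> // : mark c (m + q c + h * q (~~ c)) = false.
apply/negbTE/nm.
have qc := stage_pos st c; have qe := stage_pos st (~~ c).
have : h * q (~~ c) < b * q (~~ c) by rewrite ltn_pmul2r.
by move: qc; clear; lia.
Qed.

(* With a prefix repeated at distance [n] and then diverging, the marked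
   positions near the prefix form one abelian class of windows of length
   [n + q (~~ c)]; at the divergence two consecutive returns to a mark are
   merged into a fourth one. *)
Lemma three_mark_returns c m1 d1 m2 d2 m3 d3 :
  mark_return c m1 d1 -> mark_return c m2 d2 -> mark_return c m3 d3 ->
  ~~ uniq [:: d1; d2; d3].
Proof.
move=> r1 r2 r3; apply/negP => ud.
(* Large enough for the three given gaps, with the occurrences of [p] at their ends, to lie inside
   the repeated prefix. *)
pose M := (m1 + d1 + (m2 + d2) + (m3 + d3) + q (~~ c) + l).+2.
have [i [n [e [n0 Me hi hj [vi vj]]]]] := diverging_prefix rec_v ape_v M c.
have hij t : t < e -> v (i + n + t) = v (i + t) by move=> te; rewrite hi ?hj.
have cntn t : t <= e -> cnt c (i + t) n = cnt c i n.
  elim: t => [|t IH] te; first by rewrite addn0.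
  have := cnt_slide v c (i + t) n; rewrite IH; last exact: ltnW.
  have -> : v (i + t + n) = v (i + t) by rewrite addnAC hij.
  by rewrite addnS; clear; lia.
pose N := n + q (~~ c).
(* The first [n] letters contribute a constant, and the last [q (~~ c)] letters one more exactly at
   a mark. Hence level [K] of the windows of length [N] picks out the marks. *)
have lev t : t <= e -> cnt c (i + t) N = cnt c i n + a c + mark c (i + n + t).
  move=> te; rewrite cntD cntn // (stage_cnt st) addnA;
    congr (_ + nat_of_bool _).
  by rewrite /mark addnAC.
pose K := (cnt c i n + a c).+1.
have levK t : t <= e -> (cnt c (i + t) N == K) = mark c (i + n + t).
  by move=> te; rewrite lev // /K; case: mark; clear; lia.
have mk0 t : t + l < e -> mark c (i + n + t) = mark c t.
  by move=> te; rewrite (mark_agree _ hj te) add0n.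
have copy m d : mark_return c m d -> m + d + l < e ->
    areturn c N K (i + m) (i + (m + d)) /\
      rclass c (i + m) (i + (m + d)) = (d, cnt c m d).
  case=> d0 mm mmd nm le.
  have me : m <= e by move: le; clear; lia.
  have mde : m + d <= e by move: le; clear; lia.
  split; last first.
    rewrite /rclass; have -> : i + (m + d) - (i + m) = d by clear; lia.
    by congr (_, _); exact: eq_cnt (agree_sub hi mde).
  split.
  - by move: d0; clear; lia.
  - apply/eqP; rewrite levK // mk0 //; by move: le; clear; lia.
  - by apply/eqP; rewrite levK // mk0.
  - move=> k hk; have [t tE] : exists t, k = i + t by exists (k - i);
    move: hk; clear; lia.
    have ht : m < t < m + d by move: hk; rewrite tE; clear; lia.
    have te : t + l < e by move: ht le; clear; lia.
    apply/eqP; rewrite tE levK ?mk0 ?nm //; by move: te; clear; lia.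
have le1 : m1 + d1 + l < e by move: Me; rewrite /M; clear; lia.
have le2 : m2 + d2 + l < e by move: Me; rewrite /M; clear; lia.
have le3 : m3 + d3 + l < e by move: Me; rewrite /M; clear; lia.
have om1 : occ m1.+1 by case: r1 => _ /andP[].
have ne : v (i + e) != v (i + n + e) by rewrite vi vj; case: (c).
have le : l <= e by move: le1; clear; lia.
have [i0 eE] : exists i0, e = i0 + l by exists (e - l); rewrite subnK.
have oi0 : occ i0.
  have := diverging_occ st om1 _ hi hj ne; rewrite eE addnK; apply.
  by move: le1; case: (r1) => d0 _ _ _; move: d0; rewrite eE; clear; lia.
have occi k : agree k 0 e -> occ (k + i0).
  move=> hk; rewrite (occ_agree _ (j := i0)) // -[X in agree _ X]add0n.
  by apply: agree_sub hk _; rewrite eE.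
have ex : exists t, (t <= e) && mark c (i + n + t).
  exists m1; rewrite mk0; last by move: le1; clear; lia.
  by case: r1 => _ -> _ _; rewrite andbT; move: le1; clear; lia.
have bd t : (t <= e) && mark c (i + n + t) -> t <= e by case/andP.
case: (ex_maxnP ex bd) => t0 /andP[t0e mt0] t0max.
(* The copy at [i + n] continues with [~~ c], so by [next_mark] its next mark after [i0] lies beyond
   [e]. *)
have t0i : t0 < i0.
  rewrite ltnNge; apply/negP => it.
  have := @next_mark c (i + n + i0) (i + n + t0);
    rewrite occi // -addnA -eE vj leq_add2l => /(_ isT erefl mt0 it).
  by move: t0e; rewrite eE; clear; lia.
have t0l : t0 + l < e by rewrite eE ltn_add2r.
have mt : mark c t0 by rewrite -mk0.
have ot0 : occ t0.+1 by case/andP: mt.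
have [|cc ccE] := @occ_run c t0.+1 i0 ot0 oi0 t0i.
  move=> k /andP[tk ki]; rewrite -mk0; last by rewrite eE ltn_add2r.
  have ke : k <= e by move: ki; rewrite eE; clear; lia.
  by apply/negP => mk; have := t0max k; rewrite mk ke => /(_ isT);
    rewrite leqNgt tk.
have mi0 : mark c (i + t0) by rewrite (mark_agree _ hi) // add0n.
have [j1 j1E [cj1 j1min]] : exists2 j1, i + e < j1 & cnt c j1 N = K /\
    forall k, i + e < k < j1 -> cnt c k N <> K.
  have exj : exists j, (i + e < j) && (cnt c j N == K).
    have [j hj1 hj2] := rec_v (i + t0) N (i + e).+1; exists j; rewrite hj1 /=.
    by rewrite (eq_cnt _ hj2) levK.
  case: (ex_minnP exj) => j /andP[ij /eqP cj] jmin; exists j => //;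
    split=> // k /andP[ek kj] ck.
  by have := jmin k; rewrite ek ck eqxx => /(_ isT); rewrite leqNgt kj.
have r4 : areturn c N K (i + t0) j1.
  split=> //.
  - by move: j1E t0e; clear; lia.
  - by apply/eqP; rewrite levK.
  - move=> k /andP[tk kj]; have [ke|ke] := leqP k (i + e);
    last by apply: j1min; rewrite ke.
    have [t tE] : exists t, k = i + t by exists (k - i); move: tk; clear; lia.
    apply/eqP; rewrite tE in tk ke *; rewrite leq_add2l in ke; rewrite levK //.
    by apply/negP => mk; have := t0max t; rewrite ke mk => /(_ isT); move: tk;
      clear; lia.
have [[a1 c1] [a2 c2] [a3 c3]] :=
  And3 (copy _ _ r1 le1) (copy _ _ r2 le2) (copy _ _ r3 le3).
(* The return [r4] passes over the mark that ends the block of type [c] at [i + i0]. This mark is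
   [q c + cc * q (~~ c)] after [i + t0], hence one of the terms of [cnt_run], whereas in a gap of
   the same length all these terms vanish. *)
suff diff m d : mark_return c m d -> (d, cnt c m d) != rclass c (i + t0) j1.
  move: (few_returnsC few a1 a2 a3 r4); rewrite c1 c2 c3 /= !inE.
  rewrite !negb_or !diff // !xpair_eqE; move: ud; rewrite /= !inE.
  by case: (d1 == d2) (d1 == d3) (d2 == d3) => [] [] [].
move=> r; apply/negP; rewrite xpair_eqE => /andP[/eqP dE /eqP].
rewrite -dE; have [b bE] := mark_return_length r.
rewrite bE in r *; rewrite (cnt_mark_return r) cntD cnt_run.
have mm : mark c m by case: r.
rewrite (cnt_mark mm mi0) => /eqP;
  rewrite -addnA eqn_add2l -[X in X == _]addn0 eqn_add2l eq_sym.
have ccb : cc < b.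
  have q0 := stage_pos st (~~ c).
  rewrite -(ltn_pmul2r q0) -(ltn_add2l (q c)) -bE dE.
  have := stage_lenc st c; move: j1E q0; rewrite eE ccE.
  by clear; lia.
rewrite (bigD1 (Ordinal ccb)) //=.
have -> // : mark c (i + (t0 + q c) + cc * q (~~ c)) = true.
have ti0 : type (i + i0) = c by rewrite -addnA -eE.
have [<- _] := mark_next (occi _ hi) ti0.
by congr mark; have := stage_pos st c; rewrite ccE; clear; lia.
Qed.

(** Let [~~ c] be the letter before the final [p] of a diverging prefix. The doubled [c] gives the
    gap [q c]. The last mark of [c] in the prefix is followed by a nonempty run of blocks of type
    [~~ c]; the next block has type [c] in one copy and lengthens the run in the other, which gives
    two further gaps. *)
Lemma not_all_doubled :
  ~ forall c, exists j, [/\ v j = c, occ j.+1 & type j.+1 = c].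
Proof.
move=> dbl.
have mkex c : exists m, mark c m.
  by have [j [vj oj _]] := dbl c; exists j; rewrite /mark vj eqxx.
have [[mT mkT] [mF mkF]] := (mkex true, mkex false).
have [i [n [e [n0 Me hi hj [vi vj]]]]] :=
  diverging_prefix rec_v ape_v (mT + mF + l).+2 true.
have ne : v (i + e) != v (i + n + e) by rewrite vi vj.
have [i0 eE] : exists i0, e = i0 + l by exists (e - l); move: Me; clear; lia.
have Mi : mT + mF < i0.-1 by move: Me; rewrite eE; clear; lia.
have oi0 : occ i0.
  have oT : occ mT.+1 by case/andP: mkT.
  have := diverging_occ st oT _ hi hj ne; rewrite eE addnK; apply.
  by move: Mi; clear; lia.
have [c cE] : exists c, v i0.-1 = ~~ c by exists (~~ v i0.-1); rewrite negbK.
have [x [y [hx hy vx vy]]] : exists x y,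
    [/\ agree x 0 e, agree y 0 e, v (x + e) = c & v (y + e) = ~~ c].
  by case: (c); [exists i, (i + n) | exists (i + n), i].
have occi k : agree k 0 e -> occ (k + i0).
  move=> hk; rewrite (occ_agree _ (j := i0)) // -[X in agree _ X]add0n.
  by apply: agree_sub hk _; rewrite eE.
have mkk k t : agree k 0 e -> t < i0 -> mark c (k + t) = mark c t.
  by move=> hk ti; rewrite (mark_agree _ hk) ?add0n // eE ltn_add2r.
have ex : exists t, (t < i0) && mark c t.
  by case: (c); [exists mT | exists mF]; rewrite ?mkT ?mkF andbT; move: Mi;
    clear; lia.
have bd t : (t < i0) && mark c t -> t <= i0 by case/andP => /ltnW.
case: (ex_maxnP ex bd) => m /andP[mi mm] mmax.
have nm t : m < t < i0 -> ~~ mark c t.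
  by move=> /andP[mt ti]; apply/negP => mk; have := mmax t;
    rewrite ti mk leqNgt mt => /(_ isT).
have om : occ m.+1 by case/andP: mm.
have [|[|cc] ccE] := occ_run (c := c) om oi0 mi; first by move=> k; apply: nm.
  move: cE; rewrite ccE addn0 /=; case/andP: mm => /eqP -> _.
  by case: (c).
have [j [vj' oj tj]] := dbl c.
have lq := stage_lenc st c; have qc := stage_pos st c;
  have qe := stage_pos st (~~ c).
have r1 : mark_return c j (q c).
  have [mj nmj] := mark_next oj tj.
  split=> //.
  by rewrite /mark vj' eqxx.
have r2 : mark_return c (x + m) (q c + cc.+1 * q (~~ c)).
  have tx : type (x + i0) = c by rewrite -addnA -eE.
  have [mj nmj] := mark_next (occi _ hx) tx.
  have E : x + m + (q c + cc.+1 * q (~~ c)) = (x + i0 + q c).-1.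
    by rewrite ccE; clear; lia.
  split.
  - by move: qc; clear; lia.
  - by rewrite mkk.
  - by rewrite E.
  - rewrite E => k /andP[mk kq]; have [xk|kx] := leqP (x + i0) k.
      by apply: nmj; rewrite xk.
    have -> : k = x + (k - x) by move: mk; clear; lia.
    by rewrite mkk //; [apply: nm; move: mk kx; clear; lia | move: mk kx;
      clear; lia].
have [d dmin dlt] : exists2 d, mark_return c (y + m) d &
  q c + cc.+1 * q (~~ c) < d.
  have exd : exists d, (0 < d) && mark c (y + m + d).
    have mym : mark c (y + m) by rewrite mkk.
    have [k yk mk] := mark_after (y + m).+1 mym; exists (k - (y + m)).
    by rewrite subnKC ?mk ?andbT ?subn_gt0 // ltnW.
  case: (ex_minnP exd) => d /andP[d0 md] dmin; exists d.
    split=> //; first by rewrite mkk.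
    move=> k /andP[mk kd]; apply/negP => mkk'.
    have := dmin (k - (y + m)); rewrite subn_gt0 mk subnKC ?mkk' ?(ltnW mk) //
      => /(_ isT).
    by move: kd mk; clear; lia.
  have ty : type (y + i0) = ~~ c by rewrite -addnA -eE.
  have yd : y + i0 <= y + m + d.
    rewrite leqNgt; apply/negP => lt; move: md; rewrite -addnA (mkk _ _ hy);
      last by move: lt; clear; lia.
    by apply/negP/nm; move: lt d0; clear; lia.
  have := next_mark (occi _ hy) ty md yd.
  by rewrite ccE; move: lq qe; clear; lia.
have /negP := three_mark_returns r1 r2 dmin; apply.
rewrite /= !inE !negb_or andbT; move: dlt qe; clear.
by rewrite mulSn; lia.
Qed.

End Stage.

Lemma few_returns_balanced : balanced_word v.
Proof.
apply: (stages_balanced rec_v ape_v) => p l q a st.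
apply: contrapT => no; apply: (not_all_doubled st) => c.
apply: contrapT => noc; apply: no; exists c => j vj oj.
by apply: neqb; apply/eqP => tj; apply: noc; exists j.
Qed.

End Returns.

(** * Lexicographic order and first returns in balanced words *)

Section LexicographicOrder.
Variable v : nat -> bool.
Hypothesis rec_v : recurrent_word v.
Hypothesis ape_v : aperiodic_word v.
Hypothesis bal_v : balanced_word v.
Local Notation agree := (agree v).
Local Notation cnt := (cnt v true).

Let bal n i j : cnt i n <= (cnt j n).+1.
Proof. exact: balanced_cnt. Qed.

(** Strict lexicographic order of the suffixes at [i] and [j], with [false] before [true]. *)
Definition lexlt i j :=
  exists2 z, agree i j z & v (i + z) = false /\ v (j + z) = true.

Lemma lexlt_trans j i k : lexlt i j -> lexlt j k -> lexlt i k.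
Proof.
move=> [x axy [ix jx]] [y ayz [jy ky]]; case: (ltngtP x y) => [lt|lt|xy].
- exists x; last by rewrite -ayz.
  by move=> t tx; rewrite axy // ayz // (ltn_trans tx).
- exists y; last by rewrite axy.
  by move=> t ty; rewrite axy ?ayz // (ltn_trans ty).
- by move: jx; rewrite xy jy.
Qed.

Lemma lexltnn i : ~ lexlt i i.
Proof. by case=> z _ [-> ]. Qed.

Lemma lexlt_asym i j : lexlt i j -> ~ lexlt j i.
Proof. by move=> ij /(lexlt_trans ij); apply: lexltnn. Qed.

(** By [aperiodic_after] the word has no eventual period, so suffixes at different positions
    differ. *)
Lemma lexlt_total i j : i <> j -> lexlt i j \/ lexlt j i.
Proof.
wlog lt : i j / i < j.
  move=> W ne; case: (ltngtP i j) => [h|h|//]; first exact: W.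
  by apply/or_comm; apply: W => //; apply: nesym.
move=> _; have [|k ik vk] := aperiodic_after rec_v ape_v (T := j - i) i.
  by rewrite subn_gt0.
have ex : exists z, v (j + z) != v (i + z).
  exists (k - i); move: vk; have ->
    : k + (j - i) = j + (k - i) by move: ik lt; clear; lia.
  by rewrite subnKC.
case: (ex_minnP ex) => z vz zmin.
have ag : agree i j z.
  move=> t tz; apply/esym/eqP/negPn/negP => /zmin; by rewrite leqNgt tz.
by case vi: (v (i + z)) vz; case vj: (v (j + z)) => // _; [right | left];
   exists z => //; apply: agree_sym.
Qed.

Lemma lexlt_cnt i j n : lexlt i j -> cnt i n <= cnt j n.
Proof.
case=> z az [vi vj]; have [nz|zn] := leqP n z.
  by rewrite (eq_cnt _ (j := j)) // => t tn; apply: az; apply: leq_trans nz.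
have [r ->] : exists r, n = z + r.+1 by exists (n - z.+1); move: zn; clear; lia.
by rewrite !cntD (eq_cnt _ az) !cntS vi vj /= add0n leq_add2l bal.
Qed.

(** Otherwise the windows from just after the first difference up to the first difference after the
    jump would differ by two ones. *)
Lemma lexlt_shift i j n : lexlt i j -> cnt i n = cnt j n ->
  lexlt (i + n) (j + n).
Proof.
move=> ij eqc; have nij : i + n <> j + n.
  by move=> E; have := addIn E => E'; move: ij; rewrite E'; apply: lexltnn.
case: (lexlt_total nij) => // -[y ay [vjy viy]].
case: ij => z az [vi vj]; have [nz|zn] := leqP n z.
  exists (z - n); last by rewrite -!addnA subnKC.
  by apply: agree_sub az _; rewrite subnKC.
have [r nE] : exists r, n = z + r.+1 by exists (n - z.+1); move: zn; clear; lia.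
have E k : (k + z).+1 + r = k + n by rewrite nE; clear; lia.
have := bal (r + y.+1) (i + z).+1 (j + z).+1.
rewrite !cntD !cntSr !E (eq_cnt _ ay) vjy viy.
by move: eqc; rewrite nE !cntD (eq_cnt _ az) !cntS vi vj /=; clear; lia.
Qed.

Lemma cnt_gt_shift i j n : cnt j n < cnt i n -> lexlt (i + n) (j + n).
Proof.
move=> lt; have nij : i + n <> j + n.
  by move=> E; have := addIn E => E'; move: lt; rewrite E' ltnn.
case: (lexlt_total nij) => // -[y ay [vjy viy]].
have := bal (n + y.+1) i j.
by rewrite !cntD !cntSr (eq_cnt _ ay) vjy viy /=; move: lt; clear; lia.
Qed.

Definition up i n := lexlt i (i + n).
Definition dn i n := lexlt (i + n) i.

Lemma up_or_dn i n : 0 < n -> up i n \/ dn i n.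
Proof. by move=> n0; apply: lexlt_total; move: n0; clear; lia. Qed.

(** Sliding the window to the first difference keeps the count, and one more step replaces a [false]
    by a [true]; by balance the smaller count is minimal. *)
Lemma up_min i j n : up i n -> cnt i n <= cnt j n.
Proof.
case=> z az [vi vn]; have := bal n (i + z).+1 j.
have := cnt_slide v true (i + z) n; rewrite addnAC vi vn /=.
have : cnt i n = cnt (i + z) n.
  have := cntD v true i n z; have := cntD v true i z n.
  by rewrite -(eq_cnt _ az) addnC; clear; lia.
by clear; lia.
Qed.

Lemma dn_max i j n : dn i n -> cnt j n <= cnt i n.
Proof.
case=> z az [vi vn]; have := bal n j (i + z).+1.
have := cnt_slide v true (i + z) n; rewrite addnAC vi vn /=.
have : cnt i n = cnt (i + z) n.
  have := cntD v true i n z; have := cntD v true i z n.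
  by rewrite (eq_cnt _ az) addnC; clear; lia.
by clear; lia.
Qed.

Lemma up_dn_cnt i j n : up i n -> dn j n -> cnt j n = (cnt i n).+1.
Proof.
move=> u d; apply/eqP; rewrite eqn_leq bal /=.
case: u => z az [vi vn].
have := cnt_slide v true (i + z) n; rewrite addnAC vi vn /=.
have : cnt i n = cnt (i + z) n.
  have := cntD v true i n z; have := cntD v true i z n.
  by rewrite -(eq_cnt _ az) addnC; clear; lia.
by have := dn_max (i + z).+1 d; clear; lia.
Qed.

Lemma up_cnt i j n : up i n -> up j n -> cnt i n = cnt j n.
Proof. by move=> ui uj; apply/eqP; rewrite eqn_leq !up_min. Qed.

Lemma dn_cnt i j n : dn i n -> dn j n -> cnt i n = cnt j n.
Proof. by move=> ui uj; apply/eqP; rewrite eqn_leq !dn_max. Qed.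

(** * Three gaps for the returns to an upper set *)

Section FirstReturns.
Variable H : nat -> Prop.
Hypothesis H_up : forall i j, lexlt i j -> H i -> H j.

Definition first_return m n :=
  [/\ m < n, H m, H n & forall k, m < k < n -> ~ H k].

Variables (d u : nat).
Hypotheses (d_gt0 : 0 < d) (u_gt0 : 0 < u).
Hypothesis d_min : forall i n, 0 < n -> H i -> H (i + n) -> dn i n -> d <= n.
Hypothesis u_min : forall i n, 0 < n -> H i -> H (i + n) -> up i n -> u <= n.
Variables (x y : nat).
Hypotheses (Hx : H x) (Hxd : H (x + d)) (dx : dn x d).
Hypotheses (Hy : H y) (uy : up y u).

Let not_up i n : 0 < n -> ~ up i n -> dn i n.
Proof. by move=> n0 nu; case: (up_or_dn i n0). Qed.

Let not_dn i n : 0 < n -> ~ dn i n -> up i n.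
Proof. by move=> n0 nu; case: (up_or_dn i n0). Qed.

Let H_ups i n : H i -> up i n -> H (i + n).
Proof. by move=> Hi ui; apply: H_up ui Hi. Qed.

(* Otherwise the difference of the two jumps is a shorter jump inside [H] in the
   direction of the longer one. *)
Let not_both i : H i -> dn i d -> H (i + d) -> ~ up i u.
Proof.
move=> Hi di Hid ui; have Hiu := H_ups Hi ui.
case: (ltngtP d u) => [lt|lt|E].
- have E : i + u = i + d + (u - d) by rewrite -addnA subnKC // ltnW.
  have := @u_min (i + d) (u - d); rewrite -E subn_gt0 => /(_ lt Hid Hiu).
  have U : up (i + d) (u - d) by rewrite /up -E; apply: lexlt_trans di ui.
  by move/(_ U); move: d_gt0 u_gt0; clear; lia.
- have E : i + d = i + u + (d - u) by rewrite -addnA subnKC // ltnW.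
  have := @d_min (i + u) (d - u); rewrite -E subn_gt0 => /(_ lt Hiu Hid).
  have D : dn (i + u) (d - u) by rewrite /dn -E; apply: lexlt_trans di ui.
  by move/(_ D); move: d_gt0 u_gt0; clear; lia.
- by move: di; rewrite E; apply: lexlt_asym.
Qed.

(** By minimality of [d] an earlier return goes up, and then the rest of the jump to [i + d] is a
    shorter downward jump inside [H]. *)
Lemma first_return_dn i n : first_return i n -> dn i d -> H (i + d) ->
  n = i + d.
Proof.
move=> [lt Hi Hn nH] di Hid.
have nle : n <= i + d by rewrite leqNgt; apply/negP => g; apply: (nH _ _ Hid);
  move: g d_gt0; clear; lia.
have [//|ne] := eqVneq n (i + d).
have nu := not_both Hi di Hid.
have [k [k0 kd nE]] : exists k, [/\ 0 < k, k < d & n = i + k].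
  by exists (n - i); split; move: lt nle ne; clear; lia.
rewrite nE in Hn.
case: (up_or_dn i k0) => [uk|dk]; last first.
  by have := d_min k0 Hi Hn dk; rewrite leqNgt kd.
have E : i + d = i + k + (d - k) by rewrite -addnA subnKC // ltnW.
have D : dn (i + k) (d - k) by rewrite /dn -E; apply: lexlt_trans di uk.
have := @d_min (i + k) (d - k); rewrite -E subn_gt0 => /(_ kd Hn Hid D).
by move: k0 kd; clear; lia.
Qed.

Lemma first_return_up i n : first_return i n -> up i u -> n = i + u.
Proof.
move=> [lt Hi Hn nH] ui; have Hiu := H_ups Hi ui.
have nle : n <= i + u by rewrite leqNgt; apply/negP => g; apply: (nH _ _ Hiu);
  move: g u_gt0; clear; lia.
have [//|ne] := eqVneq n (i + u).
have [k [k0 kd nE]] : exists k, [/\ 0 < k, k < u & n = i + k].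
  by exists (n - i); split; move: lt nle ne; clear; lia.
rewrite nE in Hn.
case: (up_or_dn i k0) => [uk|dk].
  by have := u_min k0 Hi Hn uk; rewrite leqNgt kd.
have E : i + u = i + k + (u - k) by rewrite -addnA subnKC // ltnW.
have U : up (i + k) (u - k) by rewrite /up -E; apply: lexlt_trans dk ui.
have := @u_min (i + k) (u - k); rewrite -E subn_gt0 => /(_ kd Hn Hiu U).
by move: k0 kd; clear; lia.
Qed.

Let lt_x i : H i -> ~ (dn i d /\ H (i + d)) -> dn i d -> lexlt i x.
Proof.
move=> Hi no di; have nix : i <> x by move=> E; apply: no; rewrite E.
case: (lexlt_total nix) => // xi; case: no; split=> //.
by apply: H_up Hxd; apply: lexlt_shift => //; apply: dn_cnt.
Qed.

Let y_lt i : ~ up i u -> lexlt y i.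
Proof.
move=> no; have di := not_up u_gt0 no.
have nyi : y <> i by move=> E; apply: no; rewrite -E.
case: (lexlt_total nyi) => // iy.
by have := lexlt_cnt u iy; rewrite (up_dn_cnt uy di) ltnn.
Qed.

Let lt_H i j : ~ H i -> H j -> lexlt i j.
Proof.
move=> nHi Hj; have nij : i <> j by move=> E; apply: nHi; rewrite E.
by case: (lexlt_total nij) => // ji; case: nHi; apply: H_up ji Hj.
Qed.

(** Compare the two ways of cutting the window of length [u + d] at [i]: after [u] and after [d]. *)
Let mid_up i : H i -> ~ (dn i d /\ H (i + d)) -> ~ up i u -> up (i + u) d.
Proof.
move=> Hi nd nu; apply: not_dn => // dd.
have du := not_up u_gt0 nu.
have := cntD v true i u d; rewrite addnC cntD.
case: (up_or_dn i d_gt0) => [ud|ddi].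
  rewrite (up_dn_cnt ud dd); have := dn_max (i + d) du.
  by clear; lia.
rewrite (dn_cnt ddi dd) addnC => /addIn E.
have nH : ~ H (i + d) by move=> h; apply: nd.
have := lexlt_cnt u (lt_H nH Hy).
by rewrite E (up_dn_cnt uy du) ltnn.
Qed.

(** The jump [d] rises from [i + u] and falls from [x], so it lands above [x + d]. *)
Let mid_H i : H i -> ~ (dn i d /\ H (i + d)) -> ~ up i u -> H (i + u + d).
Proof.
move=> Hi nd nu; have U := mid_up Hi nd nu.
by apply: H_up Hxd; apply: cnt_gt_shift; rewrite (up_dn_cnt U dx).
Qed.

Lemma first_return_mid i n : first_return i n ->
  ~ (dn i d /\ H (i + d)) -> ~ up i u -> n = i + (u + d) /\ up (i + u) d.
Proof.
move=> [lt Hi Hn nH] nd nu; split; last exact: mid_up.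
have du := not_up u_gt0 nu; have Hm := mid_H Hi nd nu.
have nle : n <= i + u + d.
  by rewrite leqNgt; apply/negP => g; apply: (nH _ _ Hm); move: g u_gt0;
    clear; lia.
rewrite addnA; have [//|ne] := eqVneq n (i + u + d).
have [k [k0 kd nE]] : exists k, [/\ 0 < k, k < u + d & n = i + k].
  by exists (n - i); split; move: lt nle ne; clear; lia.
rewrite {}nE {n lt nle ne} in Hn nH *.
have [r [r0 kr]] : exists r, 0 < r /\ k + r = u + d.
  by exists (u + d - k); split; move: kd; clear; lia.
have Hr : H (i + k + r) by rewrite -addnA kr addnA.
case: (up_or_dn i k0) => [uk|dk]; exfalso.
(* The jump [k] is compared with the same jump from [y], which lies below [i]. It rises from both,
   so the counts over [k] agree; but over [u] the count at [i] is larger, and over the remaining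
   [k - u] it is not smaller. *)
- have uk_le := u_min k0 Hi Hn uk.
  have ukn : u != k by apply/eqP => E; apply: nu; rewrite E.
  have {}uk_lt : u < k by rewrite ltn_neqAle ukn.
  have ur : up (i + k) r.
    by apply: not_dn => // dr; have := d_min r0 Hn Hr dr; move: kr uk_lt;
      clear; lia.
  have kled : k <= d by have := u_min r0 Hn Hr ur; move: kr; clear; lia.
  have yi := y_lt nu.
  have yk : up y k.
    apply: not_dn => // dyk.
    by have := lexlt_cnt k yi; rewrite (up_dn_cnt uk dyk) ltnn.
  have Hyu := H_ups Hy uy; have Hyk := H_ups Hy yk.
  have kE : k = u + (k - u) by rewrite subnKC // ltnW.
  have k_u : 0 < k - u by rewrite subn_gt0.
  have U : up (y + u) (k - u).
    apply: not_dn => // D; have := d_min k_u Hyu;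
      rewrite -addnA -kE => /(_ Hyk D).
    by move: kled u_gt0 uk_lt; clear; lia.
  have := up_min (i + u) U; have := up_cnt uk yk.
  rewrite kE !cntD (up_dn_cnt uy du) -kE.
  by clear; lia.
(* Dually, the jump [k] falls from [i] and from [x] above it. The counts over [k] and over [d]
   agree, while the remaining [k - d] rises from [i + d] and falls from [x + d]. *)
- have dk_le := d_min k0 Hi Hn dk.
  have dkn : d != k by apply/eqP => E; apply: nd; rewrite E.
  have {}dk_lt : d < k by rewrite ltn_neqAle dkn.
  have dr : dn (i + k) r.
    by apply: not_up => // ur; have := u_min r0 Hn Hr ur; move: kr dk_lt;
      clear; lia.
  have kleu : k <= u by have := d_min r0 Hn Hr dr; move: kr; clear; lia.
  have nHd : ~ H (i + d) by apply: nH;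
    rewrite -[X in X < _]addn0 !ltn_add2l d_gt0.
  have di : dn i d.
    apply: not_up => // ud; apply: nHd; exact: H_ups.
  have ix := lt_x Hi nd di.
  have xk : dn x k.
    apply: not_up => // uxk.
    by have := lexlt_cnt k ix; rewrite (up_dn_cnt uxk dk) ltnn.
  have Hxk : H (x + k) by apply: H_up Hn; apply: lexlt_shift => //;
    apply: dn_cnt.
  have kE : k = d + (k - d) by rewrite subnKC // ltnW.
  have k_d : 0 < k - d by rewrite subn_gt0.
  have D : dn (x + d) (k - d).
    apply: not_up => // U; have := u_min k_d Hxd;
      rewrite -addnA -kE => /(_ Hxk U).
    by move: kleu d_gt0 dk_lt; clear; lia.
  have U : up (i + d) (k - d) by rewrite /up -addnA -kE; apply: lt_H.
  have := dn_cnt dk xk.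
  rewrite kE !cntD (dn_cnt di dx) (up_dn_cnt U D).
  by clear; lia.
Qed.

End FirstReturns.

Lemma lexlt_copies i j : lexlt i j -> exists N, forall n k, N <= n ->
  (agree k i n -> lexlt k j) /\ (agree k j n -> lexlt i k).
Proof.
case=> z az [vi vj]; exists z.+1 => n k zn; split=> ak; exists z.
- by move=> t tz; rewrite ak ?az // (ltn_trans tz).
- by rewrite ak.
- by move=> t tz; rewrite ak ?az // (ltn_trans tz).
- by rewrite ak.
Qed.

(** The class [c3] need not be attained, so both numbers of returns are covered. *)
Definition two_or_three_returns c s K := exists c1 c2 c3,
  [/\ c1 != c2,
      exists m n, areturn v c s K m n /\ rclass v c m n = c1,
      exists m n, areturn v c s K m n /\ rclass v c m n = c2 &
      forall m n, areturn v c s K m n -> rclass v c m n \in [:: c1; c2; c3]].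

Section MaximalLevel.
Variables (s K i0 : nat).
Hypotheses (Ki0 : cnt i0 s = K) (K_max : forall j, cnt j s <= K).
Local Notation H := (fun k => cnt k s = K).

Let H_up i j : lexlt i j -> H i -> H j.
Proof. by move=> /(lexlt_cnt s) le Hi; apply/eqP;
  rewrite eqn_leq K_max -Hi. Qed.

Let H_next i N : H i -> exists2 j, N <= j & H j.
Proof. by move=> Hi; have [j Nj h] := rec_v i s N; exists j;
  rewrite ?(eq_cnt _ h). Qed.

(** Compare [i0] with a later position [i1] of the level, and [i1] with a still later copy of [i0]
    long enough to keep the order: one jump rises and the other falls. *)
Let H_both : (exists i n, [/\ 0 < n, H i, H (i + n) & dn i n]) /\
  (exists i n, [/\ 0 < n, H i, H (i + n) & up i n]).
Proof.
have [i1 i01 Hi1] := H_next i0.+1 Ki0.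
have ne : i0 <> i1 by move: i01; clear; lia.
have E01 : i0 + (i1 - i0) = i1 by rewrite subnKC // ltnW.
have copy N : exists j, [/\ i1 < j, agree j i0 (maxn N s) & H j].
  have [j ij h] := rec_v i0 (maxn N s) i1.+1; exists j; split=> //.
  by rewrite (eq_cnt _ (j := i0)) // => t ts; apply: h;
    apply: leq_trans (leq_maxr _ _).
case: (lexlt_total ne) => lt; have [N hN] := lexlt_copies lt.
- have [j [ij h Hj]] := copy N; have [/(_ h) lt' _] := hN _ j (leq_maxl N s).
  have E : i1 + (j - i1) = j by rewrite subnKC // ltnW.
  split; [exists i1, (j - i1) | exists i0, (i1 - i0)]; split;
    rewrite ?subn_gt0 //;
    by rewrite /dn /up ?E ?E01.
- have [j [ij h Hj]] := copy N; have [_ /(_ h) lt'] := hN _ j (leq_maxl N s).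
  have E : i1 + (j - i1) = j by rewrite subnKC // ltnW.
  split; [exists i0, (i1 - i0) | exists i1, (j - i1)]; split;
    rewrite ?subn_gt0 //;
    by rewrite /dn /up ?E ?E01.
Qed.

Let minimal_move (R : nat -> nat -> Prop) :
  (exists i n, [/\ 0 < n, H i, H (i + n) & R i n]) ->
  exists i n, [/\ 0 < n, H i, H (i + n), R i n &
    forall j m, 0 < m -> H j -> H (j + m) -> R j m -> n <= m].
Proof.
move=> [i [n [n0 Hi Hin Rin]]].
have ex : exists n, `[< 0 < n /\ exists i, [/\ H i, H (i + n) & R i n] >].
  by exists n; apply/asboolP; split=> //; exists i.
case: (ex_minnP ex) => m /asboolP[m0 [j [Hj Hjm Rjm]]] mmin.
exists j, m; split=> // k r r0 Hk Hkr Rkr.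
by apply: mmin; apply/asboolP; split=> //; exists k.
Qed.

Let next_return i : H i -> exists n, first_return H i n.
Proof.
move=> Hi; have [j ij Hj] := H_next i.+1 Hi.
have ex : exists j, (i < j) && (cnt j s == K) by exists j; rewrite ij Hj eqxx.
case: (ex_minnP ex) => n /andP[lt /eqP Hn] nmin; exists n;
  split=> // k /andP[ik kn] Hk.
by have := nmin k; rewrite ik Hk eqxx leqNgt kn => /(_ isT).
Qed.

Lemma maximal_level_returns : two_or_three_returns true s K.
Proof.
have [/minimal_move[x [d [d0 Hx Hxd dx dmin]]]
      /minimal_move[y [u [u0 Hy Hyu uy umin]]]] := H_both.
(* In the third class the jump [u] falls, with one more one than at [y], and then the jump [d]
   rises, with one fewer than at [x]. *)
exists (d, cnt x d), (u, cnt y u), (u + d, (cnt y u).+1 + (cnt x d).-1).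
split.
- apply/eqP => -[E]; move: dx; rewrite E => dx.
  by rewrite (up_dn_cnt uy dx); clear; lia.
- have [n fr] := next_return Hx.
  have nE := first_return_dn H_up d0 u0 dmin umin fr dx Hxd.
  exists x, n; split; first exact: fr.
  by rewrite /rclass nE addKn.
- have [n fr] := next_return Hy.
  have nE := first_return_up H_up u0 umin fr uy.
  exists y, n; split; first exact: fr.
  by rewrite /rclass nE addKn.
move=> m n fr; have [di|nd] := EM (dn m d /\ H (m + d)).
  have nE := first_return_dn H_up d0 u0 dmin umin fr di.1 di.2.
  by rewrite /rclass nE addKn (dn_cnt di.1 dx) mem_head.
have [ui|nu] := EM (up m u).
  have nE := first_return_up H_up u0 umin fr ui.
  by rewrite /rclass nE addKn (up_cnt ui uy) !inE eqxx orbT.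
have [nE U] := first_return_mid H_up d0 u0 dmin umin Hxd dx Hy uy fr nd nu.
have du : dn m u by case: (up_or_dn m u0).
rewrite /rclass nE addKn cntD (up_dn_cnt uy du) (up_dn_cnt U dx) !inE.
by rewrite eqxx !orbT.
Qed.

End MaximalLevel.
End LexicographicOrder.

(** * Minimal levels through the complemented word *)

Section Complement.
Variable v : nat -> bool.
Let w := fun n => ~~ v n.

Lemma cnt_complement c i n : cnt w c i n = cnt v (~~ c) i n.
Proof.
elim: n i => [|n IH] i; first by rewrite !cnt0.
by rewrite !cntS IH /w; case: (v i) (c) => [] [].
Qed.

Lemma two_or_three_complement s K :
  two_or_three_returns w true s K -> two_or_three_returns v false s K.
Proof.
have rE c m n : rclass w c m n = rclass v (~~ c) m n.
  by rewrite /rclass cnt_complement.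
have aE m n : areturn w true s K m n <-> areturn v false s K m n.
  by rewrite /areturn !cnt_complement /=; split=> -[? ? ? h]; split=> // k /h;
     rewrite cnt_complement.
move=> [c1 [c2 [c3 [ne [m1 [n1 [/aE a1 r1]]] [m2 [n2 [/aE a2 r2]]] all]]]].
exists c1, c2, c3; split=> //.
- by exists m1, n1; rewrite -r1 rE.
- by exists m2, n2; rewrite -r2 rE.
- by move=> m n /aE /all; rewrite rE.
Qed.

Hypothesis rec_v : recurrent_word v.
Hypothesis ape_v : aperiodic_word v.
Hypothesis bal_v : balanced_word v.

(** By balance, a number of ones that is not maximal is minimal, hence maximal for the complemented
    word. *)
Lemma balanced_returns s i :
  exists c, two_or_three_returns v c s (cnt v c i s).
Proof.
have [max|nmax] := EM (forall j, cnt v true j s <= cnt v true i s).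
  by exists true; apply: (maximal_level_returns rec_v ape_v bal_v erefl max).
exists false; apply: two_or_three_complement.
have rec_w : recurrent_word w.
  by move=> k n N; have [j Nj h] := rec_v k n N; exists j => // t tn;
    rewrite /w h.
have ape_w : aperiodic_word w.
  move=> T T0; have [n ne] := ape_v T0; exists n.
  by apply: contra ne; rewrite /w => /eqP/negb_inj->.
have bal_w : balanced_word w.
  move=> m k j h [] /negbFE vk /negbFE vkm /negbTE vj /negbTE vjm.
  apply: (bal_v (i := j) (j := k) (m := m)); last by split.
  by move=> t tm; apply/negb_inj/esym/h.
have Ki : cnt w true i s = cnt v false i s by rewrite cnt_complement.
apply: (maximal_level_returns rec_w ape_w bal_w Ki).
move=> j; rewrite cnt_complement /=.
have /existsNP[k /negP] := nmax; rewrite -ltnNge => lt.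
have := balanced_cnt bal_v s k j.
by have := cntC v true i s; have := cntC v true j s => /=; move: lt; clear; lia.
Qed.

End Complement.

(** * Factor complexity *)

Lemma card_uniq_seq (T : eqType) (s : seq T) : uniq s ->
  ([set x | x \in s] #= `I_(size s))%classic%card.
Proof.
case: s => [|x0 s'] us.
  rewrite [X in (X #= _)%card](_ : _ = set0) ?II0 ?card_eq00 //.
  by apply/seteqP; split.
set s := x0 :: s' in us *.
rewrite [X in (X #= _)%card](_ : _ = [set nth x0 s k | k in `I_(size
  s)])%classic.
  apply: inj_card_eq => i j; rewrite !inE => si sj /eqP.
  by rewrite nth_uniq // => /eqP.
apply/seteqP; split=> x /=; first by move=> /(nthP x0)[k ks <-]; exists k.
by case=> k ks <-; exact: mem_nth.
Qed.

Section Complexity.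
Variable v : nat -> bool.
Hypothesis rec_v : recurrent_word v.
Hypothesis ape_v : aperiodic_word v.

Definition right_special n i j :=
  [/\ agree v i j n, v (i + n) = false & v (j + n) = true].

Definition factors_before n (b : bool) :=
  [set u : n.-tuple bool | `[< exists i, block v i n = u /\ v (i + n) = b >]].

Definition factors n := [set u : n.-tuple bool | `[< exists i, block v i n = u
  >]].

(** Deleting the last letter counts exactly the right special factors twice. *)
Lemma card_factorsS n : #|factors n.+1| =
  #|factors n| + #|factors_before n true :&: factors_before n false|.
Proof.
have -> : factors n = factors_before n true :|: factors_before n false.
  apply/setP => u; rewrite !inE; apply/asboolP/orP.
    by move=> [i <-]; case E: (v (i + n)); [left | right]; apply/asboolP;
      exists i.
  by case=> /asboolP[i [<- _]]; exists i.
rewrite cardsUI; pose f b (u : n.-tuple bool) := [tuple of rcons u b].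
have fI b : injective (f b).
  by move=> x y /(congr1 val) /= /rcons_inj[] E; apply: val_inj.
rewrite -(card_imset _ (fI true)) -(card_imset _ (fI false)) -cardsUI.
have -> : f true @: factors_before n true :&: f false @: factors_before n false
  = finset.set0.
  apply/setP => u; rewrite !inE; apply/andP => -[/imsetP[x _ ->] /imsetP[y _]].
  by move=> /(congr1 val) /= /rcons_inj[].
rewrite cards0 addn0; apply: eq_card => u; rewrite !inE; apply/asboolP/orP;
  last first.
  by move=> []/imsetP[x + ->]; rewrite inE => /asboolP[i [xE vi]];
    exists i; rewrite blockS vi /= xE.
move=> [i uE].
have mem b : v (i + n) = b -> u \in f b @: factors_before n b.
  move=> vi; apply/imsetP; exists (Tuple (introT eqP (size_block v i n))).
    by rewrite inE; apply/asboolP; exists i.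
  by apply: val_inj; rewrite /= -uE blockS vi.
by case E: (v (i + n)); [left | right]; apply: mem.
Qed.

Lemma card_factors0 : #|factors 0| = 1.
Proof.
rewrite (_ : factors 0 = [set [tuple]]) ?cards1 //.
apply/setP => u; rewrite !inE tuple0 eqxx; apply/asboolP; by exists 0.
Qed.

Lemma sturmianP : sturmian v <-> forall n, #|factors n| = n.+1.
Proof.
have E n : ([set u : seq bool | size u = n /\
  factor v u] #= `I_(#|factors n|))%classic%card.
  have us : uniq [seq val u | u <- enum (factors n)].
    by rewrite (map_inj_uniq val_inj) enum_uniq.
  have := card_uniq_seq us; rewrite size_map -cardE.
  rewrite [X in (X #= _)%card -> _](_ : _ = [set u : seq bool | size u = n /\
    factor v u])%classic //.
  apply/seteqP; split=> u /=.
    move=> /mapP[t + ->]; rewrite mem_enum inE => /asboolP[i it].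
    by split; rewrite ?size_tuple //; exists i;
      rewrite /occurrence /= size_tuple.
  move=> [su [i]]; rewrite /occurrence /= su => iu; apply/mapP.
  have st : size u == n by rewrite su.
  by exists (Tuple st) => //; rewrite mem_enum inE; apply/asboolP; exists i.
split=> h n; last by have := E n; rewrite h.
by apply/card_eq_II; have := h n; apply: card_eq_trans; rewrite card_eq_sym.
Qed.

Lemma right_special_ex n : exists i j, right_special n i j.
Proof.
have [i [m [e [m0 ne hi hj [vi vj]]]]] := diverging_prefix rec_v ape_v n false.
exists (i + (e - n)), (i + m + (e - n)).
have ne' : e - n + n <= e by rewrite subnK.
split; last 2 first; rewrite -?[_ + (e - n) + n]addnA ?subnK //.
exact: agree_trans (agree_sub hi ne') (agree_sym (agree_sub hj ne')).
Qed.

Lemma right_specialP n (u : n.-tuple bool) :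
  u \in factors_before n true :&: factors_before n false <->
  exists i j, right_special n i j /\ block v i n = u.
Proof.
rewrite !inE; split.
  move=> /andP[/asboolP[j [ju vj]] /asboolP[i [iu vi]]]; exists i, j.
  by split=> //; split=> //; apply/block_agree; rewrite iu ju.
move=> [i [j [[h vi vj] iu]]]; apply/andP; split; apply/asboolP;
  last by exists i.
by exists j; split=> //; rewrite -iu; apply/block_agree/agree_sym.
Qed.

(** The complexity grows by the number of right special factors, and there is always one by
    [right_special_ex]; so growth by one means uniqueness. *)
Lemma sturmian_right_special : sturmian v <->
  forall n i j i' j', right_special n i j -> right_special n i' j' ->
    agree v i i' n.
Proof.
rewrite sturmianP; split=> [h n i j i' j' r r'|h].
  have := card_factorsS n; rewrite !h => /eqP;
    rewrite -addn1 eqn_add2l eq_sym => /cards1P[u uE].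
  have inu x y : right_special n x y -> block v x n = u.
    move=> rxy; have sx : size (block v x n) == n by rewrite size_block.
    have : Tuple sx \in [set u] by rewrite -uE; apply/right_specialP;
      exists x, y.
    by rewrite inE => /eqP <-.
  by apply/block_agree; rewrite (inu _ _ r) (inu _ _ r').
elim=> [|n IH]; first exact: card_factors0.
rewrite card_factorsS IH -[in RHS]addn1; congr (_ + _); apply/eqP/cards1P.
have [i [j r]] := right_special_ex n.
have sx : size (block v i n) == n by rewrite size_block.
exists (Tuple sx); apply/setP => u; rewrite [RHS]inE; apply/idP/eqP.
  move=> /right_specialP[i' [j' [r' E]]]; apply: val_inj; rewrite /= -E.
  by apply/block_agree; apply: h r' r.
by move=> ->; apply/right_specialP; exists i, j.
Qed.

(** At the last mismatch of two right special words the letters 0 and 1 precede a common suffix z;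
    continuing each with its own first letter gives 0z0 and 1z1. *)
Lemma balanced_sturmian : balanced_word v -> sturmian v.
Proof.
move=> bal; apply/sturmian_right_special =>
  n i j i' j' [ij vi vj] [ij' vi' vj'].
apply: contrapT => nag.
have ex : exists t, (t < n) && (v (i + n - t.+1) != v (i' + n - t.+1)).
  apply: contrapT => none; apply: nag => t tn.
  apply/eqP/negPn/negP => ne; apply: none; exists (n - t.+1).
  have E k : k + n - (n - t.+1).+1 = k + t by move: tn; clear; lia.
  by rewrite !E ne andbT; move: tn; clear; lia.
case: (ex_minnP ex) => t /andP[tn vt] tmin.
have sm s : s < t -> v (i + n - s.+1) = v (i' + n - s.+1).
  move=> s_t; apply/eqP/negPn/negP => ne.
  by have := tmin s; rewrite ne (ltn_trans s_t tn) leqNgt s_t => /(_ isT).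
have E k s : s < t -> k + n - (t - s.+1).+1 = (k + n - t.+1).+1 + s.
  by move: tn; clear; lia.
have En k : (k + n - t.+1).+1 + t = k + n by move: tn; clear; lia.
have ag : agree v (i + n - t.+1).+1 (i' + n - t.+1).+1 t.
  by move=> s st; rewrite -!E // sm //; move: st; clear; lia.
have sub k k' s : agree v k k' n -> s < n ->
  v (k + n - s.+1) = v (k' + n - s.+1).
  by move=> h sn; rewrite -!addnBA // h // ltn_subrL (leq_ltn_trans _ sn).
have subS k k' : agree v k k' n ->
  agree v (k + n - t.+1).+1 (k' + n - t.+1).+1 t.
  by move=> h s st; rewrite -!E // (sub _ _ _ h) //; move: st tn; clear; lia.
case vit: (v (i + n - t.+1)) vt; case vit': (v (i' + n - t.+1)) => // _.
  apply: (bal t (i' + n - t.+1) (j + n - t.+1)).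
    by apply: agree_trans (agree_sym ag) (subS _ _ ij).
  by split; rewrite ?En // -(sub _ _ _ ij).
apply: (bal t (i + n - t.+1) (j' + n - t.+1)).
  by apply: agree_trans ag (subS _ _ ij').
by split; rewrite ?En // -(sub _ _ _ ij').
Qed.

(** If [p] occurred between two letters [c] for both values of [c], then 0p and 1p would both be
    right special. *)
Lemma sturmian_balanced : sturmian v -> balanced_word v.
Proof.
move=> /sturmian_right_special rs;
  apply: (stages_balanced rec_v ape_v) => p l q a st.
apply: contrapT => no.
have dbl c : exists j, [/\ v j = c, occ v p l j.+1 & v (j.+1 + l) = c].
  apply: contrapT => noc; apply: no; exists c => j vj oj.
  by apply: neqb; apply/eqP => tj; apply: noc; exists j.
(* The first block of type [~~ c] after a doubled [c] is preceded by the letter [c]. *)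
have alt c : exists j, [/\ v j = c, occ v p l j.+1 & v (j.+1 + l) = ~~ c].
  have [j [vj oj tj]] := dbl c.
  have [x [vx ox]] := occ_preceded rec_v ape_v st (~~ c).
  have mx : mark v p l (~~ c) x by rewrite /mark vx eqxx ox.
  have exm : exists m, (j < m) && mark v p l (~~ c) m.
    by have [m jm mm] := mark_after rec_v j.+1 mx; exists m; rewrite jm.
  case: (ex_minnP exm) => m /andP[jm /andP[/eqP vm om]] mmin.
  have [|b [jb bm ob mE vb]] := prev_occ st oj om; first by move: jm; clear;
    lia.
  rewrite /= vm in vb.
  have [bE|bne] := eqVneq b j.+1; first by exists j; rewrite -bE.
  have b0 : b.-1.+1 = b by move: jb; clear; lia.
  exists b.-1; rewrite b0; split=> //; apply: neqC; apply/eqP => vb1.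
  have jb1 : j < b.-1 by move: jb bne; clear; lia.
  have := mmin b.-1; rewrite /mark b0 vb1 ob eqxx jb1 => /(_ isT).
  by move: bm jb; clear; lia.
have cpag i j : occ v p l i.+1 -> occ v p l j.+1 -> v i = v j ->
  agree v i j l.+1.
  move=> /occP oi /occP oj vij [|t] tl; first by rewrite !addn0.
  by rewrite !addnS -!addSn oi ?oj.
have rsp c : exists i j, right_special l.+1 i j /\ v i = c.
  have [[x [vx ox tx]] [y [vy oy ty]]] := (dbl c, alt c).
  rewrite addSnnS in tx; rewrite addSnnS in ty.
  have xy := cpag _ _ ox oy (etrans vx (esym vy)).
  case: c vx tx vy ty => vx tx vy ty.
    by exists y, x; split=> //; split=> //; apply: agree_sym.
  by exists x, y.
have [i [j [rij vi]]] := rsp true.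
have [i' [j' [rij' vi']]] := rsp false.
have := rs _ _ _ _ _ rij rij' 0; rewrite !addn0 vi vi'.
by move/(_ isT).
Qed.

End Complexity.

(** * Classes of abelian returns *)

Lemma card_ge_seq (T : eqType) (S : set T) (s : seq T) k :
  uniq s -> (forall x, x \in s -> S x) -> (S #= `I_k)%classic%card ->
    size s <= k.
Proof.
move=> us sS Sk; rewrite -(card_le_II (size s) k) -(card_le_eqr Sk).
by rewrite -(card_le_eql (card_uniq_seq us)); apply: subset_card_le.
Qed.

Section ReturnClasses.
Variables (A : finType) (w : nat -> A) (u : seq A).
Local Notation class x := [set x' | abelian_return w u x' /\
  abelian_equiv x x']%classic.

Lemma eq_class x y : abelian_return w u x -> abelian_return w u y ->
  class x = class y <-> perm_eq x y.
Proof.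
move=> rx ry; split=> [E|/abelian_equivP xy].
  have : class x y by rewrite E; split.
  by case=> _ /abelian_equivP.
by apply/seteqP; split=> z [rz h]; split=> // a; rewrite ?xy // -xy.
Qed.

Lemma uniq_classes (s : seq (seq A)) :
  (forall x, x \in s -> abelian_return w u x) ->
  pairwise (fun x y => ~~ perm_eq x y) s -> uniq [seq class x | x <- s].
Proof.
elim: s => //= x s IH rs /andP[/allP px ps].
rewrite IH ?andbT //; last by move=> y ys; apply: rs; rewrite inE ys orbT.
apply/negP => /mapP[y ys E]; have /negP := px _ ys; apply.
by apply/(eq_class _ _).1; [exact: rs (mem_head _ _) | apply: rs;
  rewrite inE ys orbT | exact: E].
Qed.

Lemma uniq_returns k (s : seq (seq A)) : has_abelian_returns w u k ->
  (forall x, x \in s -> abelian_return w u x) ->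
  pairwise (fun x y => ~~ perm_eq x y) s -> size s <= k.
Proof.
move=> hk rs ps; rewrite -(size_map (fun x => class x)).
apply: card_ge_seq hk; first exact: uniq_classes.
by move=> C /mapP[x xs ->]; exists x => //; apply: rs.
Qed.

(** The returns outside the classes of [x1] and [x2] form at most one class; whether there is any
    decides between two and three. *)
Lemma two_or_three_classes x1 x2 :
  abelian_return w u x1 -> abelian_return w u x2 -> ~~ perm_eq x1 x2 ->
  (forall x y, abelian_return w u x -> abelian_return w u y ->
     ~~ perm_eq x x1 -> ~~ perm_eq x x2 -> ~~ perm_eq y x1 -> ~~ perm_eq y x2 ->
     perm_eq x y) ->
  has_abelian_returns w u 2 \/ has_abelian_returns w u 3.
Proof.
move=> r1 r2 n12 h.
have card_classes (s : seq (seq A)) :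
    (forall x, x \in s -> abelian_return w u x) ->
    pairwise (fun x y => ~~ perm_eq x y) s ->
    (forall x, abelian_return w u x -> has (perm_eq x) s) ->
    has_abelian_returns w u (size s).
  move=> rs ps all_s; rewrite -(size_map (fun x => class x)).
  apply: card_eq_trans (card_uniq_seq (uniq_classes rs ps)).
  rewrite [X in (X #= _)%card](_ : _ = [set C | C \in [seq class x | x <-
    s]])%classic //.
  apply/seteqP; split=> C /=; last by move=> /mapP[x /rs rx ->]; exists x.
  move=> [x rx <-]; apply/mapP; have /hasP[y ys xy] := all_s x rx.
  by exists y => //; apply/eq_class => //; apply: rs.
have [[x3 [r3 n31 n32]]|none] :=
    EM (exists x, [/\ abelian_return w u x, ~~ perm_eq x x1 & ~~ perm_eq x x2]);
    [right | left].
  apply: (card_classes [:: x1; x2; x3]).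
  - by move=> x; rewrite !inE => /or3P[] /eqP->.
  - by rewrite /= n12 ![perm_eq _ x3]perm_sym n31 n32.
  - move=> x rx /=; rewrite orbF -[X in is_true X]negbK !negb_or.
    by apply/negP => /and3P[n1 n2 /negP]; apply; apply: h.
apply: (card_classes [:: x1; x2]).
- by move=> x; rewrite !inE => /orP[] /eqP->.
- by rewrite /= n12.
- move=> x rx /=; rewrite orbF -[X in is_true X]negbK negb_or.
  by apply/negP => /andP[n1 n2]; apply: none; exists x.
Qed.

End ReturnClasses.

(** * Reduction to two letters *)

Section Words.
Variables (A : finType) (w : nat -> A).
Hypothesis rec_w : recurrent w.
Hypothesis ape_w : aperiodic w.

Lemma recurrentW : recurrent_word w.
Proof.
move=> i n N; apply: contrapT => no.
have fi : factor w (block w i n) by exists i; rewrite /occurrence /= size_block.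
apply: (rec_w fi); apply: (sub_finite_set _ (finite_II N)) => j /=.
rewrite /occurrence /= size_block => /block_agree ji.
by rewrite ltnNge; apply/negP => Nj; apply: no; exists j.
Qed.

Lemma count_slide a i n :
  count_mem a (block w i n) + (w (i + n) == a) = (w i == a) + count_mem a
    (block w i.+1 n).
Proof.
have := congr1 (count_mem a) (blockS w i n).
by rewrite -cats1 count_cat /= addn0 => <-.
Qed.

Lemma aperiodicW T : 0 < T -> exists n, w (n + T) != w n.
Proof.
move=> T0; apply: contrapT => no; apply: ape_w; exists T; split=> // n.
by apply/eqP/negPn/negP => ne; apply: no; exists n.
Qed.

(* A long repeated prefix makes every letter an abelian return of one and the
   same factor, and by aperiodicity this factor has a longer return as well. *)
Lemma three_letters_returns i j k : uniq [:: w i; w j; w k] ->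
  exists2 u, factor w u &
    ~ (has_abelian_returns w u 2 \/ has_abelian_returns w u 3).
Proof.
move=> uijk; have [n n0 hn] := recurrentW 0 (i + j + k).+1 1.
pose u := block w 0 n; have su : size u = n by rewrite size_block.
exists u; first by exists 0; rewrite /occurrence /= su.
have occS t : abelian_occurrence w u t ->
    abelian_occurrence w u t.+1 <-> w (t + n) = w t.
  rewrite /abelian_occurrence /= su => ht; split=> [h|E a].
    have := count_slide (w t) t n; rewrite eqxx ht h addnC => /addIn.
    by case: eqP.
  by have := count_slide a t n; rewrite E -ht addnC => /addnI.
have occ0 t : t <= (i + j + k).+1 -> abelian_occurrence w u t.
  elim: t => [|t IH] tle; first by rewrite /abelian_occurrence /= su.
  by apply/occS; [apply: IH; apply: ltnW | rewrite addnC hn].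
have ret t : t <= i + j + k -> abelian_return w u [:: w t].
  move=> tle; exists t, t.+1; split=> //.
  - by apply: occ0; apply: leqW.
  - exact: occ0.
  - by move=> m; clear; lia.
  - by rewrite subSnn /block /= .
(* If the class occurred at every position, [n] would be a period by [occS]. *)
have [t ot not1] : exists2 t, abelian_occurrence w u t &
  ~ abelian_occurrence w u t.+1.
  apply: contrapT => all_occ.
  have occ_all t : abelian_occurrence w u t.
    elim: t => [|t IH]; first exact: occ0.
    by apply: contrapT => nt; apply: all_occ; exists t.
  have [t /eqP] := aperiodicW n0; apply; exact/(occS t (occ_all t)).1/occ_all.
have ex : exists m, `[< t < m /\ abelian_occurrence w u m >].
  have [m tm h] := recurrentW t n t.+1; exists m; apply/asboolP; split=> //.
  by move: ot; rewrite /abelian_occurrence /= su; move/block_agree: h => ->.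
case: (ex_minnP ex) => m /asboolP[tm om] mmin.
have r4 : abelian_return w u (block w t (m - t)).
  exists t, m; split=> // x /andP[tx xm] ox.
  by have : m <= x; [apply/mmin/asboolP | rewrite leqNgt xm].
have tm1 : 1 < m - t.
  have : m != t.+1 by apply/eqP => E; apply: not1; rewrite -E.
  by move: tm; clear; lia.
have np x : ~~ perm_eq [:: w x] (block w t (m - t)).
  by apply/negP => /perm_size /=; rewrite size_block; move: tm1; clear; lia.
have np' x y : w x != w y -> ~~ perm_eq [:: w x] [:: w y].
  by move=> ne; apply/negP => /perm_mem /(_ (w x));
    rewrite !inE eqxx (negbTE ne).
have bound K : has_abelian_returns w u K -> 3 < K.
  move=> hK; apply: (uniq_returns (s := [:: [:: w i]; [:: w j]; [:: w k];
    block w t (m - t)])) hK _ _.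
    by move=> x; rewrite !inE => /or4P[] /eqP-> //; apply: ret; clear; lia.
  move: uijk; rewrite /= !inE !np !andbT negb_or => /andP[/andP[ij ik] jk].
  by rewrite !np'.
by case=> /bound.
Qed.

Lemma two_letters : ~ (exists i j k, uniq [:: w i; w j; w k]) ->
  exists a b, a != b /\ forall n, w n = if w n == a then a else b.
Proof.
move=> no; have [k wk] := aperiodicW (ltn0Sn 0).
exists (w k), (w (k + 1)); split; first by rewrite eq_sym.
move=> n; case: eqP => // /eqP nk; apply/eqP/negPn/negP => nk1.
by apply: no; exists n, k, (k + 1); rewrite /= !inE negb_or nk nk1 eq_sym wk.
Qed.

End Words.

(** * Transfer between two-letter words and boolean words *)

Section TwoLetters.
Variables (A : finType) (w : nat -> A) (a b : A).
Hypothesis ab : a != b.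
Hypothesis wE : forall n, w n = if w n == a then a else b.
Let v n := w n == a.
Let enc c := if c then a else b.

Let enc_inj : injective enc.
Proof. by case=> [] [] //= /eqP;
  rewrite ?(negbTE ab) // eq_sym (negbTE ab). Qed.

Let blockE i n : block w i n = map enc (block v i n).
Proof. by rewrite /block -map_comp; apply: eq_map => j; rewrite /= [LHS]wE. Qed.

Let perm_blockE c i m j n :
  perm_eq (block w i m) (block w j n) = ((m, cnt v c i m) == (n, cnt v c j n)).
Proof.
rewrite !blockE; apply/idP/eqP => [/(perm_map_inj enc_inj) p|[-> e]].
  have := perm_size p; rewrite !size_block => mn; congr (_, _) => //.
  by move/permP: p; apply.
apply: perm_map; apply/abelian_equivP => d.
have [->|/neqb->] := eqVneq d c; first exact: e.
rewrite -![count_mem _ _]/(cnt v (~~ c) _ n).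
by have := cntC v c i n; have := cntC v c j n; rewrite e; clear; lia.
Qed.

Let occurrenceE c i s n :
  abelian_occurrence w (block w i s) n <-> cnt v c n s = cnt v c i s.
Proof.
rewrite /abelian_occurrence /= size_block; split=> [/abelian_equivP|e].
  by rewrite (perm_blockE c) => /eqP[].
by apply/abelian_equivP; rewrite (perm_blockE c) e.
Qed.

Let returnE c i s m n :
  areturn v c s (cnt v c i s) m n ->
    abelian_return w (block w i s) (block w m (n - m)).
Proof.
case=> mn hm hn h; exists m, n; split=> //.
- exact/(occurrenceE c).
- exact/(occurrenceE c).
- by move=> k /h h' /(occurrenceE c).
Qed.

Let return_ex c i s x : abelian_return w (block w i s) x ->
  exists m n, areturn v c s (cnt v c i s) m n /\ x = block w m (n - m).
Proof.
move=> [m [n [mn /(occurrenceE c) hm /(occurrenceE c) hn h ->]]].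
exists m, n; split=> //; split=> // k /h h' e; apply: h'.
exact/(occurrenceE c).
Qed.

Let perm_returnE c m n m' n' :
  perm_eq (block w m (n - m)) (block w m' (n' - m')) = (rclass v c m n ==
    rclass v c m' n').
Proof. exact: perm_blockE. Qed.

Let sturmianE : sturmian w <-> sturmian v.
Proof.
have E n : ([set u : seq A | size u = n /\ factor w u] #=
            [set u : seq bool | size u = n /\ factor v u])%classic%card.
  rewrite [X in (X #= _)%card](_ : _ =
      [set map enc u | u in [set u : seq bool | size u = n /\
        factor v u]])%classic.
    by apply: inj_card_eq => x y _ _; apply: (inj_map enc_inj).
  apply/seteqP; split=> u /=.
    move=> [su [i]]; rewrite /occurrence /= su blockE => iu.
    exists (block v i n) => //; split; first exact: size_block.
    by exists i; rewrite /occurrence /= size_block.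
  move=> [x [sx [i ix]] <-]; rewrite size_map; split=> //; exists i.
  by rewrite /occurrence /= size_map blockE ix.
by split=> h n; have := h n; apply: card_eq_trans; rewrite // card_eq_sym.
Qed.

Hypothesis ape_w : aperiodic w.
Hypothesis rec_w : recurrent w.

Let rec_v : recurrent_word v.
Proof.
move=> i n N; have [j Nj h] := recurrentW rec_w i n N.
by exists j => // t tn; rewrite /v h.
Qed.

Let ape_v : aperiodic_word v.
Proof.
move=> T T0; have [n ne] := aperiodicW ape_w T0; exists n.
apply: contra ne => /eqP e; have vE k : w k = enc (v k) by apply: wE.
by rewrite !vE e.
Qed.

Lemma two_letters_sturmianP : sturmian w <->
  forall u : seq A, factor w u ->
    has_abelian_returns w u 2 \/ has_abelian_returns w u 3.
Proof.
split=> [/sturmianE/(sturmian_balanced rec_v ape_v) bal u [i ui]|h].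
  have <- : block w i (size u) = u by [].
  have [c [c1 [c2 [c3 [c12 [m1 [n1 [r1 E1]]] [m2 [n2 [r2 E2]]] all_r]]]]] :=
    balanced_returns rec_v ape_v bal (size u) i.
  apply: (two_or_three_classes (returnE r1) (returnE r2)).
    by rewrite (perm_returnE c) E1 E2.
  move=> _ _ /(return_ex c)[m [n [r ->]]] /(return_ex c)[m' [n' [r' ->]]].
  rewrite !(perm_returnE c) E1 E2; have := all_r _ _ r; have := all_r _ _ r'.
  rewrite !inE => /or3P[]/eqP-> /or3P[]/eqP->; rewrite ?eqxx //.
apply/sturmianE/(balanced_sturmian rec_v ape_v).
apply: (few_returns_balanced rec_v ape_v).
move=> s K m1 n1 m2 n2 m3 n3 m4 n4 r1 r2 r3 r4; apply/negP => un.
have KE : K = cnt v true m1 s by case: r1.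
rewrite KE in r1 r2 r3 r4.
have bound k : has_abelian_returns w (block w m1 s) k -> 3 < k.
  move=> hk; apply: (uniq_returns (s := [:: block w m1 (n1 - m1);
    block w m2 (n2 - m2);
    block w m3 (n3 - m3); block w m4 (n4 - m4)])) hk _ _.
    by move=> x; rewrite !inE => /or4P[] /eqP->; apply: returnE; eassumption.
  by move: un; rewrite uniq_pairwise /= !(perm_returnE true).
have fu : factor w (block w m1 s) by exists m1;
  rewrite /occurrence /= size_block.
by case: (h _ fu) => /bound.
Qed.

End TwoLetters.

Theorem theorem2 (A : finType) (w : nat -> A) :
  aperiodic w -> recurrent w ->
  (sturmian w <->
   forall u : seq A, factor w u ->
     has_abelian_returns w u 2 \/ has_abelian_returns w u 3).
Proof.
move=> ape_w rec_w.
have [[i [j [k uijk]]]|/(two_letters ape_w)[a [b [ab wE]]]] :=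
  EM (exists i j k, uniq [:: w i; w j; w k]); last first.
  exact: (two_letters_sturmianP ab wE).
(* With three letters both sides fail: some factor has more than three returns, and there are more
   than two factors of length one. *)
split=> [st|h]; last first.
  have [u fu] := three_letters_returns rec_w ape_w uijk.
  by case; apply: h.
have : size [seq [:: x] | x <- [:: w i; w j; w k]] <= 2.
  apply: card_ge_seq (st 1).
    by rewrite map_inj_uniq // => x y [].
  move=> _ /mapP[x xw ->]; split=> //.
  suff [n ->] : exists n, x = w n by exists n.
  by move: xw; rewrite !inE => /or3P[] /eqP->; [exists i | exists j | exists k].
by [].
Qed.
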